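(* Let $1<p<\infty$ and let $\Gamma$ be an uncountable set. Let $(\Pi_n)_{n=0}^\infty$ and $(\Delta_n)_{n=0}^\infty$ be admissible sequences of sets (with respect to $\Gamma$), and let $\Pi,\Delta$ be sets such that $\aleph_0<|\Pi|<|\Gamma|$ and $\aleph_0<|\Delta|<|\Gamma|$. Then $E(\Pi_n)\oplus F(\Pi)$ is isomorphic to $E(\Delta_n)\oplus F(\Delta)$ if and only if $|\Pi|=|\Delta|$ and there exists $k\in\mathbb{N}$ such that $$|\Pi_n|\leq|\Delta_{n+k}|\leq|\Pi_{n+2k}|$$ for all $n\in\mathbb{N}\cup\{0\}$.
   Context: For a set $S$ and $w:S\to(0,\infty)$, $\ell^{p,\infty}(S,w)$ is the space of all $x:S\to\mathbb{R}$ with $\|x\|=\sup_{c>0}c\,(\mu\{|x|>c\})^{1/p}<\infty$, where $\mu(A)=\sum_{s\in A}w(s)$ for $A\subseteq S$. This expression is equivalent to a norm under which the space is a Banach space. ''Isomorphic'' means linearly homeomorphic. $|A|$ denotes the cardinality of $A$; $\mathbb{N}=\{1,2,\ldots\}$. For a sequence $(\Gamma_n)_{n=0}^\infty$ of pairwise disjoint sets, $E(\Gamma_n)$ denotes $\ell^{p,\infty}(\bigcup_{n=0}^\infty\Gamma_n,w)$ with $w(\gamma)=2^n$ for $\gamma\in\Gamma_n$. For a set $S$, $F(S)$ denotes $\ell^{p,\infty}(S\times\mathbb{N},w)$ with $w(s,n)=2^{-n}$. A sequence $(\Pi_n)_{n=0}^\infty$ of pairwise disjoint sets is admissible (with respect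 to the fixed uncountable set $\Gamma$) if $|\Pi_n|\leq|\Pi_{n+1}|$ and $|\Pi_n|<\sup_m|\Pi_m|=|\Gamma|$ for all $n\geq0$. *)

(* Defs.v *)
From HB Require Import structures.
From mathcomp Require Import all_boot all_order all_algebra.
From mathcomp Require Import all_classical all_reals all_analysis.
From mathcomp Require Import lra.

Set Implicit Arguments.
Unset Strict Implicit.
Unset Printing Implicit Defensive.

Import Order.TTheory GRing.Theory Num.Theory.
Import numFieldNormedType.Exports.

Local Open Scope classical_set_scope.
Local Open Scope card_scope.
Local Open Scope ring_scope.

Section WeakLpNorm.
Context (R : realType) (p : R) (S : choiceType) (w : S -> {posnum R}).

Definition weight_measure (A : set S) : \bar R :=
  (\esum_(s in A) ((w s)%:num)%:E)%E.

Definition weak_norm (x : S -> R) : \bar R :=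
  ereal_sup [set (c%:E * weight_measure [set s | (c < `|x s|)%R] `^ p^-1)%E
            | c in [set c : R | 0 < c]].

Definition finite_weak_norm : pred (S -> R^o) :=
  fun x => (weak_norm x < +oo)%E.

End WeakLpNorm.

Section WeakLpNormTheory.
Context (R : realType) (p : R) (p_gt1 : 1 < p).
Context (S : choiceType) (w : S -> {posnum R}).
Local Notation mu := (weight_measure w).
Local Notation N := (weak_norm p w).
Implicit Types (x y : S -> R) (A B : set S).

Let p_gt0 : 0 < p. Proof. exact: lt_trans p_gt1. Qed.
Let ip_gt0 : 0 < p^-1. Proof. by rewrite invr_gt0. Qed.

Lemma weight_measure_ge0 A : (0 <= mu A)%E.
Proof. by apply: esum_ge0 => s _; rewrite lee_fin. Qed.

Lemma weight_measureU A B : (mu (A `|` B) <= mu A + mu B)%E.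
Proof.
rewrite /weight_measure esum_mkcond [X in (_ <= X + _)%E]esum_mkcond.
rewrite [X in (_ <= _ + X)%E]esum_mkcond -esumD; last 2 first.
- by move=> s _; case: ifP => _; rewrite ?lee_fin.
- by move=> s _; case: ifP => _; rewrite ?lee_fin.
apply: le_esum => s _; rewrite in_setU.
by case: (s \in A) (s \in B) => [] [] //=; rewrite -?EFinD ?addr0 ?add0r lee_fin// lerDl.
Qed.

Lemma le_weight_measure A B : A `<=` B -> (mu A <= mu B)%E.
Proof.
move=> AB; rewrite /weight_measure esum_mkcond [leRHS]esum_mkcond.
apply: le_esum => s _; case: ifPn => [/set_mem /AB /mem_set -> //|_].
by case: ifP => _; rewrite ?lee_fin.
Qed.

Let le_root (a b : \bar R) : (0 <= a -> a <= b -> a `^ p^-1 <= b `^ p^-1)%E.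
Proof.
move=> a0 ab; apply: gt0_ler_poweR => //.
- exact: ltW.
- by rewrite in_itv/= a0 leey.
- by rewrite in_itv/= (le_trans a0 ab) leey.
Qed.

Lemma weak_norm_ge x c : 0 < c ->
  (c%:E * mu [set s | (c < `|x s|)%R] `^ p^-1 <= N x)%E.
Proof. by move=> c0; apply: ereal_sup_ubound; exists c. Qed.

Lemma weak_norm_ge0 x : (0 <= N x)%E.
Proof.
apply: le_trans (weak_norm_ge x ltr01).
by rewrite mule_ge0 ?lee_fin// poweR_ge0.
Qed.

Lemma weak_norm0 : N (fun=> 0) = 0%E.
Proof.
apply/eqP; rewrite eq_le weak_norm_ge0 andbT.
apply: ge_ereal_sup => _ [c /= c0 <-].
rewrite (_ : [set s | _] = set0) /weight_measure ?esum_set0.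
  by rewrite poweR0r ?mule0// gt_eqF.
by apply/seteqP; split => // s /=; rewrite normr0 ltNge (ltW c0).
Qed.

Lemma weak_normN x : N (fun s => - x s) = N x.
Proof.
have E c : [set s | c < `|- x s|] = [set s | c < `|x s|].
  by apply/seteqP; split => s /=; rewrite normrN.
rewrite /weak_norm; congr ereal_sup; apply/seteqP.
by split => _ [c /= c0 <-]; exists c => //; rewrite E.
Qed.

Lemma le_weak_normZ (a : R) x : (N (fun s => (a * x s)%R) <= `|a|%:E * N x)%E.
Proof.
have [->|a0] := eqVneq a 0.
  under [X in N X]funext do rewrite mul0r.
  by rewrite weak_norm0 normr0 mul0e.
have na0 : 0 < `|a| by rewrite normr_gt0.
apply: ge_ereal_sup => _ [c /= c0 <-].
rewrite (_ : [set s | _] = [set s | c / `|a| < `|x s|]); last first.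
  by apply/seteqP; split => s /=; rewrite normrM ltr_pdivrMr// mulrC.
rewrite -{1}[c](divfK (lt0r_neq0 na0)) [X in (X%:E * _)%E]mulrC EFinM -muleA.
by rewrite lee_pmul2l// weak_norm_ge// divr_gt0.
Qed.

Lemma weak_normD x y :
  (N (fun s => (x s + y s)%R) <= 4%:E * maxe (N x) (N y))%E.
Proof.
apply: ge_ereal_sup => _ [c /= c0 <-].
have c20 : 0 < c / 2 by rewrite divr_gt0.
pose A := [set s | c / 2 < `|x s|]; pose B := [set s | c / 2 < `|y s|].
have sAB : [set s | c < `|x s + y s|] `<=` A `|` B.
  move=> s /= cxy; rewrite /A /B /=.
  have [xs|xs] := ltP (c / 2) `|x s|; [by left|right].
  rewrite ltNge; apply/negP => ys; move: cxy; apply/negP; rewrite -leNgt.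
  by rewrite (le_trans (ler_normD _ _))// (splitr c) lerD.
have muAB : (mu [set s | (c < `|x s + y s|)%R] <= 2%:E * maxe (mu A) (mu B))%E.
  rewrite (le_trans (le_weight_measure sAB))// (le_trans (weight_measureU _ _))//.
  by rewrite mule_natl mule2n leeD// le_max lexx ?orbT.
have m0 : (0 <= maxe (mu A) (mu B))%E by rewrite le_max weight_measure_ge0.
apply: (@le_trans _ _
    (c%:E * (2%:E * maxe (mu A `^ p^-1) (mu B `^ p^-1)))%E).
  rewrite lee_pmul2l//.
  apply: (le_trans (le_root (weight_measure_ge0 _) muAB)).
  rewrite poweRM ?lee_fin//; apply: lee_pmul; rewrite ?poweR_ge0//.
    rewrite poweR_EFin lee_fin -[leRHS]powRr1// ler_powR ?ler1n//.
    by rewrite invf_le1// ltW.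
  by case: (leP (mu A) (mu B)) => _; rewrite le_max lexx ?orbT.
rewrite muleA (_ : (c%:E * 2%:E = 4%:E * (c / 2)%:E)%E); last first.
  by rewrite -!EFinM; congr EFin; lra.
rewrite -muleA lee_pmul2l// maxeMr //; last by rewrite lee_fin ltW.
by rewrite ge_max !le_max !weak_norm_ge// orbT.
Qed.

End WeakLpNormTheory.

(* The phantom parameter [p_gt1] makes the vector space and topological
   structures declared below canonical: they do not exist for arbitrary [p]. *)
Record weak_lp (R : realType) (p : R) (p_gt1 : 1 < p) (S : choiceType)
    (w : S -> {posnum R}) := WeakLp {
  weak_lp_fun :> S -> R^o ;
  weak_lpP : weak_lp_fun \in finite_weak_norm p w }.

Section WeakLp.
Context (R : realType) (p : R) (p_gt1 : 1 < p).
Context (S : choiceType) (w : S -> {posnum R}).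

Lemma finite_weak_norm_submod_closed : submod_closed (finite_weak_norm p w).
Proof.
split=> [|a x y]; rewrite !unfold_in/=; first by rewrite weak_norm0.
rewrite /finite_weak_norm => xoo yoo.
apply: le_lt_trans (weak_normD p_gt1 w (a *: x) y) _.
rewrite lte_mul_pinfty ?lee_fin// gt_max yoo andbT.
apply: le_lt_trans (le_weak_normZ p_gt1 w a x) _.
by rewrite lte_mul_pinfty ?lee_fin.
Qed.

HB.instance Definition _ := GRing.isSubmodClosed.Build R (S -> R^o)
  (finite_weak_norm p w) finite_weak_norm_submod_closed.

HB.instance Definition _ := [isSub for @weak_lp_fun R p p_gt1 S w].
HB.instance Definition _ := [Choice of weak_lp p_gt1 w by <:].
HB.instance Definition _ := [SubChoice_isSubLmodule of weak_lp p_gt1 w by <:].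

Local Notation V := (weak_lp p_gt1 w).

(* [weak_norm] is only a quasi-norm; its uniformity, generated by the sets
   {(x, y) | weak_norm (x - y) < e}, is that of any equivalent norm. *)
Definition weak_lp_entourage : set_system (V * V) :=
  filter_from [set e : R | 0 < e]
    (fun e => [set xy : V * V |
      (weak_norm p w (xy.1 - xy.2 : V)%R < e%:E)%E]).

Let entourage_filter : Filter weak_lp_entourage.
Proof.
apply: filter_from_filter; first by exists 1 => /=.
move=> e1 e2 /= e10 e20; exists (Num.min e1 e2) => /=.
  by rewrite lt_min e10.
by move=> xy /=; rewrite EFin_min lt_min => /andP[].
Qed.

Let entourage_diagonal A : weak_lp_entourage A -> (diagonal `<=` A)%classic.
Proof.
move=> [e /= e0 eA] [x y] /diagonalP -> ; apply: eA => /=.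
by rewrite subrr weak_norm0.
Qed.

Let entourage_inv A : weak_lp_entourage A -> weak_lp_entourage (A^-1)%relation.
Proof.
move=> [e /= e0 eA]; exists e => // -[x y] /= xye; apply: eA => /=.
by rewrite -opprB weak_normN.
Qed.

Let entourage_split A : weak_lp_entourage A ->
  exists2 B, weak_lp_entourage B & ((B \; B)%relation `<=` A)%classic.
Proof.
move=> [e /= e0 eA].
exists [set xy : V * V |
      (weak_norm p w (xy.1 - xy.2 : V)%R < (e / 4)%:E)%E].
  by exists (e / 4) => //=; rewrite divr_gt0.
move=> [x y] /= [z /= xz zy]; apply: eA => /=.
rewrite (_ : _ - _ = (x - z : V) + (z - y : V) :> (S -> R^o)); last first.
  by rewrite /= addrA subrK.
apply: le_lt_trans (weak_normD p_gt1 w (x - z) (z - y)) _.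
rewrite (_ : e%:E = (4%:E * (e / 4)%:E)%E); last first.
  by rewrite -EFinM; congr EFin; lra.
by rewrite lte_pmul2l// gt_max xz zy.
Qed.

HB.instance Definition _ := isUniform.Build (weak_lp p_gt1 w) entourage_filter
  entourage_diagonal entourage_inv entourage_split.

End WeakLp.

(* The library leaves this join of its product instances undeclared. *)
HB.instance Definition _ (K : numDomainType) (V W : preTopologicalLmodType K) :=
  Topological.on (V * W)%type.

Definition isomorphic (R : numDomainType) (V W : preTopologicalLmodType R) :=
  exists (f : {linear V -> W}) (g : {linear W -> V}),
    [/\ cancel f g, cancel g f, continuous f & continuous g].

Definition card_lt (T U : Type) (A : set T) (B : set U) : Prop :=
  A #<= B /\ A #!= B.

(* [card_sup A B] : the cardinal of B is the supremum of the cardinals |A n|. *)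
Definition card_sup (T U : choiceType) (A : nat -> set T) (B : set U) : Prop :=
  (forall n, A n #<= B) /\
  (forall (V : choiceType) (C : set V), (forall n, A n #<= C) -> B #<= C).

Definition admissible (T U : choiceType) (Gamma : set T) (P : nat -> set U) :=
  [/\ trivIset setT P,
      forall n, P n #<= P n.+1,
      forall n, card_lt (P n) Gamma
    & card_sup P Gamma].

Section EF.
Context (R : realType) (p : R) (p_gt1 : 1 < p) (T : choiceType).

(* For pairwise disjoint G, the unique n such that t \in G n. *)
Definition block_index (G : nat -> set T) (t : T) : nat :=
  xget 0%N [set n | G n t].

Definition E_weight (G : nat -> set T) (t : \bigcup_n G n) : {posnum R} :=
  (2 ^+ block_index G (val t))%:pos.

Definition E_space (G : nat -> set T) := weak_lp p_gt1 (@E_weight G).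

Definition F_weight (A : set T) (t : A `*` [set n : nat | (0 < n)%N]) :
  {posnum R} := (2 ^- (val t).2)%:pos.

Definition F_space (A : set T) := weak_lp p_gt1 (@F_weight A).

End EF.

(* Main.v *)
From HB Require Import structures.
Require Import Defs.
From mathcomp Require Import all_boot all_order all_algebra finmap.
From mathcomp Require Import all_classical all_reals all_analysis.

From mathcomp Require Import lra.

Import Order.TTheory GRing.Theory Num.Theory.
Local Open Scope classical_set_scope.
Local Open Scope card_scope.
Local Open Scope ring_scope.

(** Both sides of the equivalence concern weak [L^p] spaces over one index set,
    the disjoint union of the index sets of the two summands.  A coordinate of
    weight [v] contributes a unit vector [e_s], and a space is determined by how
    many coordinates there are of each weight.

    Sufficiency.  The inequalities give injections between the unions of the
    [Pi_ n] and of the [Delta_ n] that move every block by a bounded number of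
    levels.  The Cantor-Bernstein bijection is pasted together from these
    injections ([piecewise_bernstein]), so it distorts the weights by a bounded
    factor, and reindexing along it is an isomorphism ([isomorphic_reindex]).

    Necessity.  Let [f] be an isomorphism, [C] a bound for [f] and its inverse
    with the [p]-th powers of the norms, and [d_s c] the weight of the set where
    the image [f e_s] exceeds [c] in modulus, so that
    [d_s c <= C * v / c `^ p] when [e_s] has weight [v].

    - As [1 < p], a coordinate functional is nonzero on at most countably many
      images of unit vectors of the same weight ([countable_coordinate]); thus
      uncountable families of images can be thinned out to disjointly supported
      ones ([disjoint_selection]), for which distribution functions add up.

    - Among uncountably many unit vectors of weight [v], uncountably many have
      images with [d_s c <= eta * v / c `^ p] for all small [c]
      ([uncountable_thin_below]).  Otherwise uncountably many images would be
      large at the same [L] scales [1 / N_0 > ... > 1 / N_(L-1)], and giving the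
      coefficient [N_r] to a suitable number of disjoint copies for each [r]
      yields a vector of bounded norm on which all [L] scales meet at level [1].

    - Hence the images of uncountable families of unit vectors of equal weight
      cannot be arbitrarily small in supremum norm ([no_flat_images]).
      Otherwise one chooses such families successively so that the ranges of
      values occupied by their images are essentially disjoint; a sum over [K]
      families, with multiplicities making each of them contribute equally, then
      has norm of order [K `^ p^-1], whereas its image stays bounded.

    - If the coordinates of weight below [La * v] in the target were too few,
      then all but few images of unit vectors of weight [v] would live on
      coordinates of weight at least [La * v], hence be of supremum norm at most
      [(C / La) `^ p^-1].  So some [La] satisfies [isomorphic_level_card_le]:
      every infinite cardinal bounding the number of coordinates of weight below
      [La * v] in the target also bounds the number of coordinates of weight [v]
      in the source.

    Weight [2 ^- k] with [La * 2 ^- k <= 1] singles out the coordinates of the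
    summand F and gives the comparison of [Pi] with [Delta]; weight [2 ^+ n]
    gives the comparison of [Pi_ n] with [Delta_ (n + k)], for [k] so large that
    [La <= 2 ^+ k] and that [Delta_ k] dominates [Delta]. *)

Set Implicit Arguments.
Unset Strict Implicit.
Unset Printing Implicit Defensive.

(** * Cardinal arithmetic *)

Lemma card_le_fun (T U : Type) (A : set T) (B : set U) :
  A #<= B <-> exists f : A -> B, injective f.
Proof.
split=> [/card_leP[f]|[f fI]].
  by exists f => x y fxy; apply: (@inj _ _ _ f) => //; rewrite in_setT.
have /injfunPex[g] : exists2 g : A -> B, set_fun setT setT g & set_inj setT g.
  by exists f => // x y _ _; exact: fI.
by apply/card_leP; squash g.
Qed.

Lemma inj_on_card_le (T U : Type) (A : set T) (B : set U) (f : T -> U) :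
  set_fun A B f -> set_inj A f -> A #<= B.
Proof.
move=> fAB fI.
have /injfunPex[g] : exists2 g : T -> U, set_fun A B g & set_inj A g by exists f.
exact: inj_card_le.
Qed.

Lemma surj_on_card_ge (T U : Type) (A : set T) (B : set U) (f : T -> U) :
  set_surj A B f -> B #<= A.
Proof.
move=> fS; have /surjPex[g] : exists g : T -> U, set_surj A B g by exists f.
exact: surj_card_ge.
Qed.

(** Zorn's lemma for graphs of partial injections: a maximal one must exhaust
    the domain or the range. *)
Lemma card_le_total (T U : Type) (A : set T) (B : set U) :
  A #<= B \/ B #<= A.
Proof.
pose P (G : set (T * U)) := G `<=` A `*` B /\
  forall x y, G x -> G y -> x.1 = y.1 \/ x.2 = y.2 -> x = y.
have [F FP tF|G [[GAB GI] Gmax]] := @Zorn_bigcup _ P.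
  split=> [x [X FX Xx]|x y [X FX Xx] [Y FY Yy]]; first exact: (FP X FX).1.
  have [XY|YX] := tF _ _ FX FY.
    by apply: (FP Y FY).2 => //; exact: XY.
  by apply: (FP X FX).2 => //; exact: YX.
have [Adom|/existsNP[a /not_implyP[Aa /forallNP Ga]]] :=
    pselect (forall a, A a -> exists b, G (a, b)).
  left; have /card_le_trans : A #<= G.
    apply: (@surj_on_card_ge _ _ _ _ fst) => a /Adom[b Gab].
    by exists (a, b).
  apply; apply: (@inj_on_card_le _ _ _ _ snd) => [x /GAB[]//|x y].
  by rewrite !inE => Gx Gy xy; apply: GI => //; right.
have [Bran|/existsNP[b /not_implyP[Bb /forallNP Gb]]] :=
    pselect (forall b, B b -> exists a, G (a, b)).
  right; have /card_le_trans : B #<= G.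
    apply: (@surj_on_card_ge _ _ _ _ snd) => b /Bran[a' Gab].
    by exists (a', b).
  apply; apply: (@inj_on_card_le _ _ _ _ fst) => [x /GAB[]//|x y].
  by rewrite !inE => Gx Gy xy; apply: GI => //; left.
exfalso; apply: (Gmax (G `|` [set (a, b)])).
  by rewrite properEneq; split=> [|x Gx]; [|left];
     first (by apply/eqP => GE; apply: (Ga b); rewrite GE; right).
split=> [x [/GAB//|->]//|[x1 x2] [y1 y2]].
move=> [Gx|[-> ->]] [Gy|[-> ->]] //= xy; first exact: GI.
- by case: xy => xy; [case: (Ga x2)|case: (Gb x1)]; rewrite -xy.
- by case: xy => xy; [case: (Ga y2)|case: (Gb y1)]; rewrite xy.
Qed.

(** A maximal family [X] of injective sequences in [A] with disjoint ranges
    leaves a finite part of [A] uncovered, so that [A] embeds into [X * nat],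
    which in turn embeds into [A]. *)
Lemma card_le_setX_nat (T : Type) (A : set T) :
  infinite_set A -> A `*` [set: nat] #<= A.
Proof.
move=> Ainf.
pose B : set (nat -> T) := [set e | injective e /\ range e `<=` A].
have [X [XB tX Xmax]] := ex_maximal_disjoint_subcollection
  (fun e : nat -> T => range e) B.
pose Q := A `\` \bigcup_(e in X) range e.
have Qfin : finite_set Q.
  apply: contrapT => /infiniteP/card_le_fun[e eI].
  pose e' n := val (e (exist _ n (mem_set I)) : Q).
  have e'Q n : Q (e' n) by exact: set_valP.
  have e'I : injective e' by move=> m n /val_inj/eI/(congr1 val).
  have Xe' : ~ X e'.
    by move=> Xe'; apply: (e'Q 0%N).2; exists e' => //; exists 0%N.
  apply: (Xmax (X `|` [set e'])).
  - rewrite properEneq; split; last by move=> ? ?; left.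
    by apply/eqP => XE; apply: Xe'; rewrite XE; right.
  - by move=> f [/XB//|->]; split=> // _ [n _ <-]; have [] := e'Q n.
  move=> f g [Xf|->] [Xg|->] //; first exact: tX.
  - by move=> [_ [[m _ <-] [n _ /esym fE]]]; case: (e'Q n) => _ [];
       rewrite -fE; exists f => //; exists m.
  - by move=> [_ [[m _ <-] [n _ /esym fE]]]; case: (e'Q m) => _ [];
       rewrite fE; exists g => //; exists n.
have [e0 Xe0] : X !=set0.
  apply: contrapT => /nonemptyPn X0; apply: Ainf.
  by move: Qfin; rewrite /Q X0 bigcup_set0 setD0.
have [q /= qI] : exists q : T -> nat, set_inj Q q.
  by apply/countable_injP; exact: finite_set_countable.
have XNA : X `*` [set: nat] #<= A.
  apply: (@inj_on_card_le _ _ _ _ (fun en => en.1 en.2)).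
    by move=> [e n] /= [/XB[_ eA] _]; apply: eA; exists n.
  move=> [e m] [f n]; rewrite !inE => -[/= Xe _] [Xf _] efE.
  have ef : e = f by apply: tX => //; exists (e m); split; [exists m|exists n].
  by move: Xe efE; rewrite ef => /XB[fI _] /fI ->.
apply: (card_le_trans _ XNA).
(* Odd second components are reserved for the points of [Q], all of them coded
   with the sequence [e0]. *)
have code a : {en : (nat -> T) * nat | A a -> X en.1 /\
    if odd en.2 then Q a /\ q a = en.2./2 else a = en.1 en.2./2}.
  apply: cid; have [Qa|nQa] := pselect (Q a).
    by exists (e0, (q a).*2.+1) => /= _; rewrite odd_double uphalf_double.
  have [Aa|nAa] := pselect (A a); last by exists (e0, 0%N).
  have [e Xe [n _ ea]] : (\bigcup_(e in X) range e) a.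
    by apply: contrapT => nR; apply: nQa; split.
  by exists (e, n.*2) => /=; rewrite odd_double doubleK.
pose h (an : T * nat) :=
  ((sval (code an.1)).1, choice.pickle (an.2, (sval (code an.1)).2)).
apply: (@inj_on_card_le _ _ _ _ h).
  by move=> [a n] [/= Aa _]; split=> //=; case: (code a) => en /= /(_ Aa)[].
move=> [a m] [b n]; rewrite !inE => -[/= Aa _] [/= Ab _].
rewrite /h /=; case: (code a) => -[e i] /= /(_ Aa)[Xe aE].
case: (code b) => -[f j] /= /(_ Ab)[Xf bE] [ef].
move=> /(pcan_inj choice.pickleK) [-> ij].
suff -> : a = b by [].
move: aE bE; rewrite ef ij; case: ifP => _; last by move=> -> ->.
move=> [Qa qa] [Qb qb]; apply: qI; rewrite ?inE//; exact: etrans qa (esym qb).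
Qed.

Lemma card_le_inj_on (T U : Type) (A : set T) (B : set U) :
  U -> A #<= B -> exists2 f : T -> U, set_fun A B f & set_inj A f.
Proof.
move=> b0 /card_le_fun[f fI].
pose g t := if pselect (A t) is left At then val (f (exist _ t (mem_set At)))
            else b0.
exists g => [t At|s t]; rewrite /g.
  by case: pselect => // ?; exact: set_valP.
rewrite !inE => As At; do 2 case: pselect => // ?.
by move=> /val_inj/fI/(congr1 val).
Qed.

Lemma card_le_bigcup_countable {I T U : Type} (D : set U) (J : set I)
    (F : I -> set T) :
  infinite_set D -> J #<= D -> (forall i, J i -> countable (F i)) ->
  \bigcup_(i in J) F i #<= D.
Proof.
move=> Dinf JD Fc; apply: (card_le_trans _ (card_le_setX_nat Dinf)).
have [d0 _] := infinite_setN0 Dinf; have [e eD eI] := card_le_inj_on d0 JD.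
have /choice[g gP] i : exists g : T -> nat, J i -> set_inj (F i) g.
  have [/Fc/countable_injP[g gI]|nJi] := pselect (J i); first by exists g.
  by exists (fun=> 0%N).
have [[i0 Ji0]|/nonemptyPn J0] := pselect (J !=set0); last first.
  by rewrite J0 bigcup_set0; exact: card_ge0.
have /choice[ix ixP] t : exists i, (\bigcup_(i in J) F i) t -> J i /\ F i t.
  have [[i Ji Fit]|nt] := pselect ((\bigcup_(i in J) F i) t); first by exists i.
  by exists i0.
apply: (@inj_on_card_le _ _ _ _ (fun t => (e (ix t), g (ix t) t))).
  by move=> t /ixP[/eD].
move=> s t; rewrite !inE => /ixP[Js Fs] /ixP[Jt Ft] [est].
have ist : ix s = ix t by apply: eI; rewrite ?inE.
by rewrite ist in Fs *; apply: (gP _ Jt); rewrite inE.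
Qed.

Lemma card_le_bigcup_nat {T U : Type} (D : set U) (F : nat -> set T) :
  infinite_set D -> (forall n, F n #<= D) -> \bigcup_n F n #<= D.
Proof.
move=> Dinf FD; apply: (card_le_trans _ (card_le_setX_nat Dinf)).
have [d0 _] := infinite_setN0 Dinf.
have /choice[g gP] n : exists g : T -> U, set_fun (F n) D g /\ set_inj (F n) g.
  by have [g gD gI] := card_le_inj_on d0 (FD n); exists g.
have /choice[ix ixP] t : exists n, (\bigcup_n F n) t -> F n t.
  have [[n _ Fnt]|nt] := pselect ((\bigcup_n F n) t); first by exists n.
  by exists 0%N.
apply: (@inj_on_card_le _ _ _ _ (fun t => (g (ix t) t, ix t))).
  by move=> t /ixP Ft; split=> //=; exact: (gP _).1.
move=> s t; rewrite !inE => /ixP Fs /ixP Ft [+ ist].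
by rewrite ist in Fs *; apply: (gP _).2; rewrite ?inE.
Qed.

(** The Cantor-Bernstein bijection is built piecewise from the two injections,
    which is what transfers their distortion bounds to it. *)
Lemma piecewise_bernstein (S S' : Type) (f : S -> S') (g : S' -> S) :
  injective f -> injective g ->
  exists (h : S -> S') (h' : S' -> S), [/\ cancel h h', cancel h' h &
    forall s, h s = f s \/ s = g (h s)].
Proof.
move=> fI gI.
(* [D] consists of the points whose backward orbit ends outside the range of
   [g]; on it the bijection follows [f], elsewhere the inverse of [g]. *)
pose D s := exists n s0, ~ range g s0 /\ s = iter n (g \o f) s0.
have gD s : ~ D s -> exists t, g t = s.
  move=> nDs; apply: contrapT => ns; apply: nDs; exists 0%N, s; split=> //.
  by move=> [t _ ts]; apply: ns; exists t.
have /choice[h hP] s : exists t, (D s -> t = f s) /\ (~ D s -> g t = s).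
  have [Ds|nDs] := pselect (D s); first by exists (f s).
  by have [t ts] := gD _ nDs; exists t.
have Dgf s t : D s -> g t = s -> exists2 s', D s' & f s' = t.
  move=> [[|n] [s0 [ns0 ->]]] gts; first by case: ns0; exists t.
  by exists (iter n (g \o f) s0); [exists n, s0|apply: gI; rewrite gts].
have hI : injective h.
  move=> s t hst; have [Ds|nDs] := pselect (D s); have [Dt|nDt] := pselect (D t).
  - by apply: fI; rewrite -(hP s).1// -(hP t).1.
  - exfalso; apply: (nDt); rewrite -((hP t).2 nDt) -hst ((hP s).1 Ds).
    by case: Ds => n [s0 [? ->]]; exists n.+1, s0.
  - exfalso; apply: (nDs); rewrite -((hP s).2 nDs) hst ((hP t).1 Dt).
    by case: Dt => n [s0 [? ->]]; exists n.+1, s0.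
  - by rewrite -((hP s).2 nDs) -((hP t).2 nDt) hst.
have /choice[h' h'P] t : exists s, h s = t.
  have [Dgt|nDgt] := pselect (D (g t)); last first.
    by exists (g t); apply: gI; exact: (hP _).2.
  by have [s' Ds' <-] := Dgf _ _ Dgt erefl; exists s'; exact: (hP _).1.
exists h, h'; split=> // s; first by apply: hI; rewrite h'P.
have [Ds|nDs] := pselect (D s); first by left; exact: (hP s).1.
by right; rewrite (hP s).2.
Qed.

(** * Distribution functions *)

Section Distribution.
Context (R : realType) (S : choiceType) (w : S -> {posnum R}).
Local Notation mu := (weight_measure w).
Implicit Types (x y : S -> R) (A B : set S) (c : R).

Definition dist x c : \bar R := mu [set s | c < `|x s|].

Lemma weight_measure_disjointU A B : A `&` B = set0 ->
  mu (A `|` B) = (mu A + mu B)%E.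
Proof.
move=> AB0; rewrite /weight_measure (esumID A (A `|` B)); last first.
  by move=> s _; rewrite lee_fin.
rewrite setUK setIUl setICr set0U; congr (_ + esum _ _)%E.
apply/seteqP; split=> [s []//|s Bs]; split=> // As.
by have : (A `&` B) s by []; rewrite AB0.
Qed.

Lemma weight_measure_set1 s : mu [set s] = ((w s)%:num)%:E.
Proof. by rewrite /weight_measure esum_set1// lee_fin. Qed.

Lemma weight_measure0 : mu set0 = 0%E.
Proof. exact: esum_set0. Qed.

Lemma dist_ge0 x c : (0 <= dist x c)%E.
Proof. exact: weight_measure_ge0. Qed.

Lemma le_dist x c c' : c <= c' -> (dist x c' <= dist x c)%E.
Proof. by move=> cc'; apply: le_weight_measure => s /=; exact: le_lt_trans. Qed.

Lemma dist_ge_point x c s : c < `|x s| -> (((w s)%:num)%:E <= dist x c)%E.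
Proof.
by move=> cs; rewrite -weight_measure_set1; apply: le_weight_measure => t /= ->.
Qed.

Lemma distZ a x c : 0 < a -> dist (fun s => a * x s) c = dist x (c / a).
Proof.
move=> a0; rewrite /dist; congr mu; apply/seteqP.
by split=> s /=; rewrite normrM gtr0_norm// [a * _]mulrC ltr_pdivrMr.
Qed.

Lemma dist_indic s c : 0 <= c ->
  dist (fun t => (t == s)%:R) c = (if c < 1 then (w s)%:num else 0)%:E.
Proof.
move=> c0; rewrite /dist; case: ifPn => [c1|].
  rewrite -weight_measure_set1; congr mu; apply/seteqP.
  split=> [t|t ->] /=; last by rewrite eqxx normr1.
  by case: eqP => // _; rewrite normr0 ltNge c0.
rewrite -leNgt => c1; rewrite -[RHS]weight_measure0; congr mu; apply/seteqP.
split=> t //=; case: eqP => _; first by rewrite normr1 ltNge c1.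
by rewrite normr0 ltNge c0.
Qed.

Lemma dist_sum_disjoint (J : eqType) (r : seq J) (a : J -> R)
    (y : J -> S -> R) c :
    0 <= c -> uniq r ->
    (forall i j, i \in r -> j \in r -> i != j ->
      forall s, y i s = 0 \/ y j s = 0) ->
  dist (fun s => \sum_(j <- r) a j * y j s) c =
  (\sum_(j <- r) dist (fun s => (a j * y j s)%R) c)%E.
Proof.
move=> c0; elim: r => [_ _|i r IH /= /andP[ir ur] dr].
  rewrite big_nil -weight_measure0; congr mu; apply/seteqP.
  by split=> s //=; rewrite big_nil normr0 ltNge c0.
have y0 s j : y i s != 0 -> j \in r -> y j s = 0.
  move=> yis jr; have [||||//] := dr i j _ _ _ s;
    rewrite ?mem_head ?in_cons ?jr ?orbT//.
    by apply: contraNneq ir => ->.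
  by move/eqP; rewrite (negPf yis).
rewrite big_cons -IH//; last first.
  by move=> j k jr kr; apply: dr; rewrite in_cons ?jr ?kr orbT.
rewrite /dist -weight_measure_disjointU; last first.
  apply/seteqP; split=> s // -[/= ci]; rewrite big_seq big1 ?normr0 ?ltNge ?c0//.
  move=> j jr; rewrite y0 ?mulr0//; apply: contraTneq ci => ->.
  by rewrite mulr0 normr0 -leNgt.
congr mu; apply/seteqP; split=> s /=; rewrite big_cons.
  have [->|yis] := eqVneq (y i s) 0; first by rewrite mulr0 add0r => ?; right.
  rewrite [X in _ + X]big_seq big1 ?addr0; first by left.
  by move=> j jr; rewrite y0 ?mulr0.
have [->|yis] := eqVneq (y i s) 0.
  by rewrite mulr0 add0r normr0 [_ < 0]ltNge c0 => -[].
rewrite big_seq big1; last by move=> j jr; rewrite y0 ?mulr0.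
by rewrite addr0 normr0 [_ < 0]ltNge c0 => -[].
Qed.

Lemma weight_measure_infinite A e : 0 < e -> infinite_set A ->
  (forall s, A s -> e <= (w s)%:num) -> mu A = +oo%E.
Proof.
move=> e0 Ainf Ae; apply/eq_infty => M.
have [F FA cF] := infinite_set_fset (Num.truncn (M / e)).+1 Ainf.
apply: esum_ge; exists [set` F]; first by split=> //; exact: finite_fset.
rewrite fsbig_finite//= set_fsetK sumEFin lee_fin.
apply: (@le_trans _ _ (\sum_(s <- finmap.enum_fset F) e)).
  rewrite big_const_seq count_predT iter_addr_0 -mulr_natr -ler_pdivrMl// mulrC.
  by rewrite (le_trans (ltW (truncnS_gt _)))// ler_nat.
by rewrite big_seq [leRHS]big_seq; apply: ler_sum => s sF; exact: Ae (FA _ sF).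
Qed.

(** On each set where [x] and the weight are both bounded away from [0] there
    are finitely many points, and countably many such sets cover the support. *)
Lemma countable_support x : (forall c, 0 < c -> (dist x c < +oo)%E) ->
  countable [set s | x s != 0].
Proof.
move=> xoo; pose A (nm : nat * nat) : set S :=
  [set s | nm.1.+1%:R^-1 < `|x s| /\ nm.2.+1%:R^-1 <= (w s)%:num].
have inv_nat_lt (e : R) : 0 < e -> exists n : nat, n.+1%:R^-1 < e.
  move=> e0; exists (Num.truncn e^-1).
  by rewrite -[ltRHS]invrK ltf_pV2 ?posrE ?invr_gt0// truncnS_gt.
apply: (@sub_countable _ _ _ (\bigcup_nm A nm)).
  apply: subset_card_le => s /= xs.
  have [n nP] := inv_nat_lt _ (etrans (normr_gt0 _) xs).
  have [m mP] := inv_nat_lt _ (gt0 (w s)).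
  by exists (n, m) => //; split => //=; exact: ltW.
apply: bigcup_countable => // -[n m] _; apply: finite_set_countable.
apply: contrapT => /(@weight_measure_infinite _ (m.+1%:R^-1)) Aoo.
have : (mu (A (n, m)) < +oo)%E.
  apply: le_lt_trans (xoo n.+1%:R^-1 _); last by rewrite invr_gt0.
  by apply: le_weight_measure => s [].
by rewrite Aoo ?invr_gt0// => s [].
Qed.

End Distribution.

(** * Greedy selection *)

Lemma countable_setD_nonempty (T : Type) (A B : set T) :
  ~ countable A -> countable B -> exists t, A t /\ ~ B t.
Proof.
move=> Auc Bc; apply: contrapT => /forallNP AB; apply: Auc.
apply: sub_countable Bc; apply: subset_card_le => t At.
by apply: contrapT => nBt; exact: (AB t).
Qed.

Lemma countable_setU (T : Type) (A B : set T) :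
  countable A -> countable B -> countable (A `|` B).
Proof.
move=> Ac Bc; rewrite -bigcup2E; apply: bigcup_countable => // n _.
by rewrite /bigcup2; case: n => [|[|n]].
Qed.

Lemma uncountable_fiber (T : Type) (A : set T) (F : nat -> set T) :
  ~ countable A -> A `<=` \bigcup_n F n -> exists n, ~ countable (A `&` F n).
Proof.
move=> Auc AF; apply: contrapT => /forallNP nF; apply: Auc.
have -> : A = \bigcup_n (A `&` F n).
  by rewrite -setI_bigcupr; apply/esym/setIidl.
by apply: bigcup_countable => // n _; exact: contrapT (nF n).
Qed.

(** The choices are made one after the other along an enumeration of [J]: each
    of them has to avoid finitely many countable sets only. *)
Lemma greedy_selection (J : countType) (S : choiceType) (u : J -> set S)
    (bad : S -> S -> Prop) :
    (forall s t, bad s t -> bad t s) ->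
    (forall j, ~ countable (u j)) ->
    (forall j s, countable [set t | u j t /\ bad s t]) ->
  exists sigma : J -> S, (forall j, u j (sigma j)) /\
    forall i j, i != j -> ~ bad (sigma i) (sigma j).
Proof.
move=> badC uuc badc; have [j0|J0] := pselect (exists j : J, True); last first.
  have F (j : J) : False by apply: J0; exists j.
  by exists (fun j => match F j with end); split=> j; case: (F j).
case: j0 => j0 _; pose v (n : nat) := u (odflt j0 (choice.unpickle n)).
have /choice[g gP] (l : seq S) :
    exists t, v (size l) t /\ forall s, s \in l -> ~ bad s t.
  have [||t [vt nbt]] := @countable_setD_nonempty _ (v (size l))
    (\bigcup_(s in [set` l]) [set t | v (size l) t /\ bad s t]).
  - exact: uuc.
  - apply: bigcup_countable => [|s _]; last exact: badc.
    exact/finite_set_countable/finite_seq.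
  by exists t; split=> // s sl bst; apply: nbt; exists s.
pose L n := iter n (fun l => rcons l (g l)) [::].
have sizeL n : size (L n) = n by elim: n => // n IH; rewrite /= size_rcons IH.
have memL i n : (i < n)%N -> g (L i) \in L n.
  elim: n => // n IH; rewrite ltnS leq_eqVlt /= mem_rcons in_cons.
  by move=> /orP[/eqP->|/IH->]; rewrite ?eqxx ?orbT.
exists (fun j => g (L (choice.pickle j))); split=> [j|i j ij].
  by have [] := gP (L (choice.pickle j)); rewrite sizeL /v choice.pickleK.
have : choice.pickle i != choice.pickle j.
  by apply: contra_neq ij => /(pcan_inj choice.pickleK).
rewrite neq_ltn => /orP[] /memL; first exact: (gP _).2.
by move=> /(gP _).2 nb /badC.
Qed.

(** * Weak-type bounds and families equivalent to the unit vectors *)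

(** The bound [weak_norm p w x <= B `^ p^-1], freed of roots and of the
    supremum.  Bounded operators act on [B] by a constant factor. *)
Definition weak_le (R : realType) (p : R) (S : choiceType) (w : S -> {posnum R})
    (x : S -> R) (B : R) :=
  forall c, 0 < c -> (dist w x c <= (B / c `^ p)%:E)%E.

Definition combination (R : realType) (J S S' : Type) (f : S -> S' -> R)
    (r : seq J) (a : J -> R) (s : J -> S) : S' -> R :=
  fun t => \sum_(j <- r) a j * f (s j) t.

Definition unit_vector (R : realType) (S : eqType) (s : S) : S -> R :=
  fun t => (t == s)%:R.

Lemma powR_lt1_le1 (R : realType) (p c : R) :
  0 <= p -> 0 < c -> c < 1 -> c `^ p <= 1.
Proof.
move=> p0 c0 c1; have -> : 1 = 1 `^ p :> R by rewrite powR1.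
by rewrite ge0_ler_powR ?nnegrE// ltW.
Qed.

Section UnitVectorFamily.
Context (R : realType) (p : R) (p_gt1 : 1 < p).
Context (S S' : choiceType) (w : S -> {posnum R}) (w' : S' -> {posnum R}).
Context (tau : S -> S' -> R) (C : R) (C_gt0 : 0 < C).
Hypothesis tau_bounded : forall (J : Type) (r : seq J) a s B, 0 < B ->
  weak_le p w (combination (@unit_vector R S) r a s) B ->
  weak_le p w' (combination tau r a s) (C * B).

Let p_gt0 : 0 < p. Proof. exact: lt_trans p_gt1. Qed.

Lemma dist_tau s c : 0 < c ->
  (dist w' (tau s) c <= (C * (w s)%:num / c `^ p)%:E)%E.
Proof.
move=> c0; have E (T : Type) (f : S -> T -> R) :
    combination f [:: tt] (fun=> 1) (fun=> s) = f s.
  by apply/funext => t; rewrite /combination big_seq1 mul1r.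
rewrite -E; apply: tau_bounded => // b b0; rewrite E dist_indic; last exact: ltW.
case: ifPn => [b1|_]; rewrite lee_fin ?divr_ge0 ?powR_ge0//.
rewrite ler_pdivlMr ?powR_gt0// ler_piMr//.
exact: powR_lt1_le1 (ltW p_gt0) _ _.
Qed.

Lemma countable_support_tau s : countable [set t | tau s t != 0].
Proof.
apply: (@countable_support _ _ w') => c c0.
by apply: le_lt_trans (dist_tau s c0) _; rewrite ltry.
Qed.

(** A coordinate functional that is at least [1 / j.+1] in modulus on [n] unit
    vectors of weight [v] is at least [n / j.+1] at their sum with suitable
    signs, whose norm is only [(n * v) `^ p^-1]; as [1 < p], this bounds [n]. *)
Lemma countable_coordinate v t :
  countable [set s | (w s)%:num = v /\ tau s t != 0].
Proof.
pose A (j : nat) : set S :=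
  [set s | (w s)%:num = v /\ j.+1%:R^-1 < `|tau s t|].
apply: (@sub_countable _ _ _ (\bigcup_j A j)).
  apply: subset_card_le => s [/= ws ts].
  exists (Num.truncn `|tau s t|^-1) => //.
  split=> //; rewrite -[ltRHS]invrK ltf_pV2 ?posrE ?invr_gt0 ?normr_gt0//.
  exact: truncnS_gt.
apply: bigcup_countable => // j _; apply: finite_set_countable.
apply: contrapT => Ainf.
have [s0 [ws0 _]] := infinite_setN0 Ainf.
have v0 : 0 < v by rewrite -ws0.
pose q : R := j.+1%:R; have q0 : 0 < q by rewrite ltr0n.
have wt0 : 0 < (w' t)%:num by [].
(* The bound for the sum of [n] vectors at level [n / (2 * q)] amounts to
   [n `^ (p - 1) <= Q]. *)
pose Q := C * v * (2 * q) `^ p / (w' t)%:num.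
have Q0 : 0 <= Q.
  by rewrite /Q !mulr_ge0 ?powR_ge0 ?invr_ge0 ?(ltW C_gt0) ?(ltW v0)// ltW.
pose N := (Num.truncn (Q `^ (p - 1)^-1)).+1.
have [F FA cF] := infinite_set_fset N Ainf.
pose r := finmap.enum_fset F; pose n : R := (size r)%:R.
have n0 : 0 < n by rewrite ltr0n (leq_trans _ cF).
have rA s : s \in r -> A j s by move=> sr; exact: FA.
pose a s := Num.sg (tau s t).
have a1 s : s \in r -> a s != 0 /\ `|a s| = 1.
  move=> /rA[_ ts]; have ts0 : tau s t != 0.
    by rewrite -normr_gt0; apply: le_lt_trans ts; rewrite invr_ge0 ltW.
  by rewrite /a sgr_eq0 normr_sg ts0.
have xB : weak_le p w (combination (@unit_vector R S) r a id) (n * v).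
  move=> c c0; rewrite /combination.
  rewrite dist_sum_disjoint ?finmap.fset_uniq ?(ltW c0)//.
    rewrite big_seq (eq_bigr (fun=> (if c < 1 then v else 0)%:E)); last first.
      move=> s sr; have [_ as1] := a1 _ sr; have [<- _] := rA _ sr.
      rewrite -dist_indic; last exact: ltW.
      rewrite /dist; congr weight_measure; apply/seteqP.
      by split=> t' /=; rewrite normrM as1 mul1r.
    rewrite -big_seq sumEFin lee_fin big_const_seq count_predT iter_addr_0.
    rewrite -mulr_natl -/n -mulrA ler_pM2l//.
    case: ifPn => c1; last by rewrite divr_ge0 ?powR_ge0 ?(ltW v0).
    rewrite ler_pdivlMr ?powR_gt0// ler_piMr ?(ltW v0)//.
    exact: powR_lt1_le1 (ltW p_gt0) _ _.
  move=> s1 s2 _ _ s12 s3; rewrite /unit_vector.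
  case: eqP => [->|_]; last by left.
  by right; rewrite (negPf s12).
have y_large : n / (2 * q) < `|combination tau r a id t|.
  rewrite /combination ger0_norm; last first.
    by apply: sumr_ge0 => s _; rewrite /a -normrEsg.
  apply: (@lt_le_trans _ _ (n / q)).
    by rewrite ltr_pM2l// ltf_pV2 ?posrE ?mulr_gt0// ltr_pMl// ltr1n.
  have -> : n / q = \sum_(s <- r) q^-1.
    by rewrite big_const_seq count_predT iter_addr_0 -mulr_natl.
  rewrite big_seq [leRHS]big_seq; apply: ler_sum => s /rA[_ /ltW].
  by rewrite /a -normrEsg.
have c0 : 0 < n / (2 * q) by rewrite divr_gt0 ?mulr_gt0.
have := le_trans (dist_ge_point w' y_large)
  (tau_bounded (mulr_gt0 n0 v0) xB c0).
rewrite lee_fin leNgt => /negP; apply.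
rewrite ltr_pdivrMr ?powR_gt0//.
have nE : n `^ p = n * n `^ (p - 1).
  by rewrite -{2}(powRr1 (ltW n0)) -powRD ?(gt_eqF n0) ?implybT// addrC subrK.
have pE : n `^ p = (n / (2 * q)) `^ p * (2 * q) `^ p.
  by rewrite -powRM ?(ltW c0) ?mulr_ge0 ?(ltW q0)// divfK ?gt_eqF ?mulr_gt0.
have nQ : Q < n `^ (p - 1).
  have p10 : 0 < p - 1 by rewrite subr_gt0.
  have <- : (Q `^ (p - 1)^-1) `^ (p - 1) = Q.
    by rewrite -powRrM mulVf ?gt_eqF// powRr1.
  rewrite gt0_ltr_powR ?nnegrE ?powR_ge0 ?(ltW n0)//.
  by apply: lt_le_trans (truncnS_gt _) _; rewrite ler_nat.
have q20 : 0 < (2 * q) `^ p by rewrite powR_gt0 ?mulr_gt0.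
rewrite -(ltr_pM2r q20) -[ltRHS]mulrA -pE nE.
by rewrite /Q ltr_pdivrMr// -(ltr_pM2l n0) in nQ; lra.
Qed.

(** Images of unit vectors can be made disjointly supported: by
    [countable_coordinate], each image meets only countably many others. *)
Lemma disjoint_selection (J : countType) (u : J -> set S) (v : J -> R) :
    (forall j, ~ countable (u j)) ->
    (forall j s, u j s -> (w s)%:num = v j) ->
  exists sigma : J -> S, [/\ forall j, u j (sigma j), injective sigma &
    forall i j, i != j -> forall t, tau (sigma i) t = 0 \/ tau (sigma j) t = 0].
Proof.
move=> uuc uv.
pose bad s1 s2 := s1 = s2 \/ exists t, tau s1 t != 0 /\ tau s2 t != 0.
have [| ||sigma [usigma nbad]] := @greedy_selection J S u bad.
- by move=> s1 s2 [->|[t []]]; [left|right; exists t].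
- exact: uuc.
- move=> j s; apply: (@sub_countable _ _ _ ([set s] `|`
      \bigcup_(t in [set t | tau s t != 0])
        [set s' | (w s')%:num = v j /\ tau s' t != 0])); last first.
    apply: countable_setU; first exact: countable1.
    apply: bigcup_countable => [|t _]; first exact: countable_support_tau.
    exact: countable_coordinate.
  apply: subset_card_le => s' [us' [->|[t [st s't]]]]; first by left.
  by right; exists t => //; split=> //; exact: uv us'.
exists sigma; split=> // [i j ij|i j ij t].
  by apply/eqP/negPn/negP => /nbad; apply; left.
have [->|it] := eqVneq (tau (sigma i) t) 0; first by left.
have [->|jt] := eqVneq (tau (sigma j) t) 0; first by right.
by case: (nbad _ _ ij); right; exists t.
Qed.

(** The pair [(i, l)] stands for the [l]-th member of the [i]-th block, a block
    consisting of vectors with equal weights and equal coefficients. *)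
Definition block_indices (K : nat) (m : nat -> nat) : seq (nat * nat) :=
  [seq (i, l) | i <- index_iota 0 K, l <- index_iota 0 (m i)].

Lemma block_indices_uniq K m : uniq (block_indices K m).
Proof.
apply: allpairs_uniq_dep; [exact: iota_uniq|move=> i _; exact: iota_uniq|].
by move=> [i l] [j k] _ _ /= [-> ->].
Qed.

Lemma dist_unit_blocks (K : nat) (m : nat -> nat) (a v : nat -> R)
    (sigma : nat * nat -> S) c :
    0 < c -> (forall i, 0 < a i) -> injective sigma ->
    (forall i l, (w (sigma (i, l)))%:num = v i) ->
  dist w
    (combination (@unit_vector R S) (block_indices K m) (a \o fst) sigma) c =
  (\sum_(0 <= i < K) if c < a i then (m i)%:R * v i else 0)%:E.
Proof.
move=> c0 a0 sI wv; rewrite /combination.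
rewrite dist_sum_disjoint ?(ltW c0)//; last 2 first.
- exact: block_indices_uniq.
- move=> i j _ _ ij t; rewrite /unit_vector; case: eqP => [->|_]; last by left.
  by right; rewrite (inj_eq sI) (negPf ij).
rewrite big_allpairs_dep -sumEFin; apply: eq_bigr => i _ /=.
under eq_bigr do
  rewrite distZ// dist_indic ?divr_ge0 ?(ltW c0) ?(ltW (a0 _))// wv
          ltr_pdivrMr// mul1r.
rewrite sumEFin big_const_seq count_predT size_iota subn0 iter_addr_0.
by case: ifP => _; rewrite ?mul0rn// mulr_natl.
Qed.

Lemma dist_tau_blocks (K : nat) (m : nat -> nat) (a : nat -> R)
    (sigma : nat * nat -> S) c :
    0 < c -> (forall i, 0 < a i) ->
    (forall i j, i != j ->
      forall t, tau (sigma i) t = 0 \/ tau (sigma j) t = 0) ->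
  dist w' (combination tau (block_indices K m) (a \o fst) sigma) c =
  (\sum_(0 <= i < K) \sum_(0 <= l < m i)
    dist w' (tau (sigma (i, l))) (c / a i))%E.
Proof.
move=> c0 a0 sD; rewrite /combination.
rewrite dist_sum_disjoint ?(ltW c0)//; last 2 first.
- exact: block_indices_uniq.
- by move=> i j _ _; exact: sD.
rewrite big_allpairs_dep; apply: eq_bigr => i _; apply: eq_bigr => l _.
exact: distZ (a0 i).
Qed.

(** Multiplicities for which finitely many blocks, of masses [q i] per vector,
    have total masses equal up to a factor [2]. *)
Lemma balanced_multiplicities (K : nat) (q : nat -> R) : (forall i, 0 < q i) ->
  exists2 M, 0 < M & exists m : nat -> nat,
    forall i, (i < K)%N -> M <= (m i)%:R * q i <= 2 * M.
Proof.
move=> q0; pose M := \sum_(0 <= i < K) q i + 1.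
have M0 : 0 < M by rewrite ltr_wpDl// sumr_ge0// => i _; exact: ltW.
exists M => //; exists (fun i => (Num.truncn (M / q i)).+1) => i iK.
have qM : q i <= M.
  rewrite /M (bigD1_seq i) ?mem_index_iota ?iota_uniq//= -addrA lerDl.
  by rewrite addr_ge0// sumr_ge0// => j _; exact: ltW.
have /andP[t1 t2] := truncn_itv (ltW (divr_gt0 M0 (q0 i))).
rewrite ler_pdivlMr// in t1.
by rewrite -ler_pdivrMr// (ltW t2)/= -natr1 mulrDl mul1r; lra.
Qed.

(** The terms decay at least like powers of [2 `^ - p <= 2^-1], so the sum is
    at most twice its first nonzero term. *)
Lemma geometric_sum (a : nat -> R) (L i0 : nat) c :
    0 < c -> (forall i, 0 < a i) ->
    (forall i j, (i < j)%N -> 2 * a i <= a j) ->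
  \sum_(i <- iota i0 L) (if c <= a i then (a i `^ p)^-1 else 0) <=
  2 * (c `^ p)^-1.
Proof.
move=> + a0 a2; elim: L i0 c => [|L IH] i0 c c0.
  by rewrite big_nil mulr_ge0// invr_ge0 powR_ge0.
rewrite big_cons; case: ifPn => [ca|_]; last by rewrite add0r; exact: IH.
have ap : (a i0 `^ p)^-1 <= (c `^ p)^-1.
  rewrite lef_pV2 ?posrE ?powR_gt0//.
  by rewrite ge0_ler_powR ?nnegrE ?(ltW c0) ?(ltW p_gt0)// ltW.
apply: (@le_trans _ _ ((a i0 `^ p)^-1 + (a i0 `^ p)^-1)); last first.
  by rewrite mulr_natl mulr2n lerD.
rewrite lerD2l; have a20 : 0 < 2 * a i0 by rewrite mulr_gt0.
apply: le_trans (le_trans (IH i0.+1 _ a20) _).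
  rewrite big_seq [leRHS]big_seq; apply: ler_sum => i.
  rewrite mem_iota => /andP[/a2 -> _]; case: ifP => // _.
  by rewrite invr_ge0 powR_ge0.
rewrite powRM ?(ltW (a0 _))// invfM mulrA ler_piMl ?invr_ge0 ?powR_ge0//.
rewrite ler_pdivrMr ?powR_gt0// mul1r -[leLHS]powRr1// ler_powR ?ler1n//.
exact: ltW.
Qed.

(** The unit vectors of weight [v] whose images have, at all levels up to [c0],
    at most the fraction [eta] of the weight that a vector of norm [v `^ p^-1]
    may have there. *)
Definition thin_below (v eta c0 : R) : set S :=
  [set s | forall c, 0 < c <= c0 ->
    (dist w' (tau s) c <= (eta * v / c `^ p)%:E)%E].

(** Suppose that only countably many members of [U] are thin below any [c0].
    Then uncountably many images reach, at infinitely many levels [1 / N], at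
    least the fraction [eta'] of the maximal weight.  As there are only
    countably many finite sequences of integers, uncountably many images do so
    at the same [L] levels [1 / N 0, ..., 1 / N L.-1], with [N] at least
    doubling at each step.  The combination of disjoint images with [m r]
    coefficients [N r], where [m r * v * N r `^ p] is about [M], exceeds [1] on
    a set of weight at least [L * eta' * M]; but by [geometric_sum] the same
    combination of unit vectors satisfies [weak_le] with bound [4 * M]. *)
Lemma uncountable_thin_below (v eta : R) (U : set S) : 0 < eta ->
    ~ countable U -> (forall s, U s -> (w s)%:num = v) ->
  exists2 c0, 0 < c0 & ~ countable (U `&` thin_below v eta c0).
Proof.
move=> eta0 Uuc Uv; apply: contrapT => noc0.
have {noc0}Uc c0 : 0 < c0 -> countable (U `&` thin_below v eta c0).
  by move=> c00; apply: contrapT => Unc; apply: noc0; exists c0.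
pose thin := \bigcup_(j : nat) (U `&` thin_below v eta j.+1%:R^-1).
pose V := U `\` thin.
have Vuc : ~ countable V.
  move=> Vc; apply: Uuc; apply: (@sub_countable _ _ _ (V `|` thin)).
    apply: subset_card_le => s Us.
    by have [?|?] := pselect (thin s); [right|left].
  apply: countable_setU => //; apply: bigcup_countable => // j _.
  by apply: Uc; rewrite invr_gt0.
have v0 : 0 < v.
  have [s Us] : U !=set0.
    apply: contrapT => /nonemptyPn U0.
    by apply: Uuc; rewrite U0; exact: countable0.
  by rewrite -(Uv s Us).
(* Rounding a level [c <= 1] down to the reciprocal of an integer costs at most
   a factor [2], hence a factor [2 `^ p] on [c `^ p]. *)
pose eta' := eta / 2 `^ p.
have eta'0 : 0 < eta' by rewrite divr_gt0 ?powR_gt0.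
pose good s (N : nat) := (0 < N)%N /\
  ((eta' * v * N%:R `^ p)%:E <= dist w' (tau s) N%:R^-1)%E.
have goodV s j : V s -> exists2 N, (j <= N)%N & good s N.
  move=> [Us nbig]; have : ~ thin_below v eta j.+1%:R^-1 s.
    by move=> sts; apply: nbig; exists j.
  move=> /existsNP[c /not_implyP[/andP[c0 cj] /negP]]; rewrite -ltNge => dc.
  have jc : j.+1%:R <= c^-1 by rewrite -[leLHS]invrK lef_pV2 ?posrE ?invr_gt0.
  have /andP[t1 t2] := truncn_itv (le_trans (ler0n _ _) jc).
  exists (Num.truncn c^-1).+1.
    rewrite -ltnS -(ltr_nat R) (le_lt_trans _ (lt_le_trans t2 _))// ?ler_nat//.
    by rewrite (le_trans _ jc)// ler_nat.
  split=> //; apply: le_trans (le_trans (ltW dc) _); last first.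
    by apply: le_dist; rewrite -[leRHS]invrK lef_pV2 ?posrE ?invr_gt0// ltW.
  have c1 : c <= 1.
    by rewrite (le_trans cj)// invf_le1// ler1n.
  rewrite lee_fin /eta' -!mulrA ler_pM2l// [leLHS]mulrCA ler_pM2l//.
  rewrite ler_pdivrMl ?powR_gt0// ler_pdivlMr ?powR_gt0// -powRM ?(ltW c0)//.
  rewrite ge0_ler_powR ?nnegrE ?mulr_ge0 ?(ltW c0) ?(ltW p_gt0)//.
  rewrite -(ler_pM2r c0) mulVf ?gt_eqF// in t1.
  by rewrite -natr1 mulrDl mul1r; lra.
have [L LP] : exists L : nat, 4 * C / eta' < L%:R.
  by exists (Num.truncn (4 * C / eta')).+1; exact: truncnS_gt.
have /choice[Ns NsP] s : exists N : nat -> nat, V s ->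
    forall r, good s (N r) /\ (2 * N r <= N r.+1)%N.
  have [Vs|nVs] := pselect (V s); last by exists (fun=> 0%N).
  have /choice[g gP] j : exists N, (j <= N)%N /\ good s N.
    by have [N ? ?] := goodV s j Vs; exists N.
  exists (fun r => iter r (fun N => g (2 * N)%N) (g 0%N)) => _ r; split.
    by case: r => [|r] /=; exact: (gP _).2.
  exact: (gP _).1.
pose F n := [set s | choice.pickle (mkseq (Ns s) L) = n].
have [|n Wuc] := @uncountable_fiber _ V F Vuc.
  by move=> s _; exists (choice.pickle (mkseq (Ns s) L)).
pose W := V `&` F n; have {}Wuc : ~ countable W by [].
have [s1 [Vs1 Fs1]] : W !=set0.
  apply: contrapT => /nonemptyPn W0.
  by apply: Wuc; rewrite W0; exact: countable0.
pose N := Ns s1.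
have Wgood s r : W s -> (r < L)%N -> good s (N r).
  move=> [Vs Fs] rL; rewrite (_ : N r = Ns s r); first exact: (NsP s Vs r).1.
  rewrite -(nth_mkseq 0%N (Ns s) rL) -(nth_mkseq 0%N N rL); congr nth.
  by apply: (pcan_inj choice.pickleK); rewrite /N Fs1 Fs.
pose a i : R := (N i)%:R.
have a0 i : 0 < a i by rewrite ltr0n; have [[]] := NsP s1 Vs1 i.
have a2 i j : (i < j)%N -> 2 * a i <= a j.
  elim: j => // j IH; rewrite ltnS leq_eqVlt => /orP[/eqP ->|/IH ij].
    by rewrite -natrM ler_nat; have [] := NsP s1 Vs1 j.
  apply: le_trans ij _; apply: le_trans (_ : 2 * a j <= _).
    by rewrite ler_peMl ?ler1n// ltW.
  by rewrite -natrM ler_nat; have [] := NsP s1 Vs1 j.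
have [M M0 [m mP]] := balanced_multiplicities L
  (fun i => mulr_gt0 v0 (powR_gt0 p (a0 i))).
have [||sigma [sW sI sD]] :=
  @disjoint_selection (nat * nat)%type (fun=> W) (fun=> v).
- by [].
- by move=> _ s [[Us _] _]; exact: Uv.
have /(tau_bounded (mulr_gt0 (ltr0n R 4) M0))/(_ 1 ltr01) :
    weak_le p w (combination (@unit_vector R S)
      (block_indices L m) (a \o fst) sigma) (4 * M).
  move=> c c0; rewrite (dist_unit_blocks _ _ (v := fun=> v))//; last first.
    by move=> i l; have [[Us _] _] := sW (i, l); exact: Uv.
  rewrite lee_fin.
  apply: (@le_trans _ _ (2 * M * \sum_(i <- iota 0 L)
      (if c <= a i then (a i `^ p)^-1 else 0))); last first.
    apply: le_trans (ler_wpM2l _ (geometric_sum L 0 c0 a0 a2)) _.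
      by rewrite mulr_ge0// ltW.
    lra.
  rewrite mulr_sumr /index_iota subn0 big_seq [leRHS]big_seq.
  apply: ler_sum => i; rewrite mem_iota add0n => /mP/andP[_ mM].
  case: ifPn => [/ltW ->|_]; last first.
    rewrite mulr_ge0 ?(ltW M0)//; first by rewrite mulr_ge0// ltW.
    by case: ifP => // _; rewrite invr_ge0 powR_ge0.
  by rewrite ler_pdivlMr ?powR_gt0// -mulrA.
rewrite dist_tau_blocks//; apply/negP; rewrite -ltNge powR1 divr1.
apply: (@lt_le_trans _ _ (\sum_(0 <= i < L) eta' * M)%:E).
  rewrite big_const_nat subn0 iter_addr_0 lte_fin -mulr_natl.
  by rewrite ltr_pdivrMr// -(ltr_pM2r M0) in LP; lra.
rewrite -sumEFin big_seq [leRHS]big_seq; apply: lee_sum => i.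
rewrite mem_index_iota => /andP[_ iL].
apply: (@le_trans _ _ (\sum_(0 <= l < m i) (eta' * v * (N i)%:R `^ p)%:E)%E).
  rewrite sumEFin big_const_nat subn0 iter_addr_0 lee_fin -(mulr_natl _ (m i)).
  have /andP[mM _] := mP _ iL; rewrite -(ler_pM2l eta'0) /= /a in mM; lra.
apply: lee_sum => l _; rewrite div1r.
exact: (Wgood _ _ (sW (i, l)) iL).2.
Qed.

(** A single coordinate of large weight already exceeds the total weight that
    the image may have at level [c]. *)
Lemma dist_tau_eq0 s c La :
  0 < c -> (forall t, tau s t != 0 -> La <= (w' t)%:num) ->
  C * (w s)%:num < La * c `^ p -> dist w' (tau s) c = 0%E.
Proof.
move=> c0 tauLa LaC; rewrite -[RHS](weight_measure0 w'); congr weight_measure.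
apply/seteqP; split=> // t /= ct.
have := le_trans (dist_ge_point w' ct) (dist_tau s c0).
rewrite lee_fin => wt; have /tauLa Lat : tau s t != 0.
  by apply: contraTneq ct => ->; rewrite normr0 -leNgt ltW.
by have := le_trans Lat wt; rewrite leNgt ltr_pdivrMr ?powR_gt0// LaC.
Qed.

Hypothesis tau_bounded_below : forall (J : Type) (r : seq J) a s B, 0 < B ->
  weak_le p w' (combination tau r a s) B ->
  weak_le p w (combination (@unit_vector R S) r a s) (C * B).

(** Let families with images of arbitrarily small supremum norm exist. Construct
    [thr 0 >= thr 1 >= ...] and families [U i] whose images are bounded by
    [thr i] and thin below [thr i.+1]. In a sum of [K] blocks of equal mass [M],
    taken from [U 0, ..., U K.-1] with coefficients [1], at most one block is
    not thin at a given level [c], namely the one with [thr i.+1 < c < thr i].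
    So the image satisfies [weak_le] with a bound of order [M * (C + K * eta)],
    whereas the sum itself has weight at least [K * M] at level [1 / 2]; for
    [eta] small and [K] large this is absurd. *)
Lemma no_flat_images :
  ~ (forall c1, 0 < c1 -> exists v U, [/\ ~ countable U,
      forall s, U s -> (w s)%:num = v &
      forall s c, U s -> c1 <= c -> dist w' (tau s) c = 0%E]).
Proof.
move=> flat; pose eta := (4 * C * 2 `^ p)^-1.
have eta0 : 0 < eta by rewrite invr_gt0 !mulr_gt0// powR_gt0.
have /choice[stage stageP] c1 : exists vUc : R * set S * R, 0 < c1 ->
    [/\ 0 < vUc.2 <= c1, ~ countable vUc.1.2,
      forall s, vUc.1.2 s -> (w s)%:num = vUc.1.1,
      forall s c, vUc.1.2 s -> c1 <= c -> dist w' (tau s) c = 0%E &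
      vUc.1.2 `<=` thin_below vUc.1.1 eta vUc.2].
  have [c10|/negP c10] := boolP (0 < c1); last by exists (0, set0, 0).
  have [v [U [Uuc Uv Uc1]]] := flat _ c10.
  have [c0 c00 Usm] := uncountable_thin_below eta0 Uuc Uv.
  exists (v, U `&` thin_below v eta c0, Num.min c0 c1) => _ /=; split=> //.
  - by rewrite lt_min c00 c10 ge_min lexx orbT.
  - by move=> s [/Uv].
  - by move=> s c [Us _]; exact: Uc1.
  - move=> s [_ sm] c /andP[c0' cm]; apply: sm; rewrite c0' /=.
    by apply: le_trans cm _; rewrite ge_min lexx.
pose thr i := iter i (fun c => (stage c).2) 1.
have thr0 i : 0 < thr i.
  by elim: i => //= i IH; have [/andP[]] := stageP _ IH.
have thrS i : thr i.+1 <= thr i by have [/andP[]] := stageP _ (thr0 i).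
pose v i := (stage (thr i)).1.1; pose U i := (stage (thr i)).1.2.
have Uuc i : ~ countable (U i) by have [] := stageP _ (thr0 i).
have Uv i s : U i s -> (w s)%:num = v i.
  by have [_ _ + _ _] := stageP _ (thr0 i); apply.
have v0 i : 0 < v i.
  have [s Us] : U i !=set0.
    apply: contrapT => /nonemptyPn U0.
    by apply: (Uuc i); rewrite U0; exact: countable0.
  by rewrite -(Uv i s Us).
pose jump c i : bool := thr i.+1 < c < thr i.
have jumps c K : (\sum_(0 <= i < K) jump c i <= (thr K < c)%R)%N.
  elim: K => [|K IH]; first by rewrite big_nil.
  rewrite big_nat_recr //=; have := IH; rewrite /jump.
  have [cK|cK] := ltP (thr K) c; last first.
    rewrite leqn0 => /eqP ->; rewrite add0n; case: ltP => //= cK1.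
    by case: ltP.
  rewrite (le_lt_trans (thrS K) cK)/=.
  by rewrite [c < _]ltNge (ltW cK) addn0.
have dU i s c : 0 < c -> U i s ->
    (dist w' (tau s) c <= (v i / c `^ p * (eta + C * (jump c i)%:R))%:E)%E.
  move=> c0 Us; have [_ _ _ far near] := stageP _ (thr0 i).
  have vc0 : 0 <= v i / c `^ p by rewrite divr_ge0 ?powR_ge0// ltW.
  have [cle|clt] := leP (thr i) c.
    rewrite (far _ _ Us cle) lee_fin mulr_ge0// addr_ge0 ?(ltW eta0)//.
    by rewrite mulr_ge0// ltW.
  have [cle|cgt] := leP c (thr i.+1).
    apply: le_trans (near _ Us _ _) _; first by rewrite c0.
    rewrite lee_fin mulrDr -[_ * v i / _]mulrA [eta * _]mulrC lerDl.
    by rewrite mulr_ge0// mulr_ge0// ltW.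
  apply: le_trans (dist_tau s c0) _.
  rewrite lee_fin (Uv _ _ Us) /jump cgt clt mulr1 mulrDr -mulrA [C * _]mulrC.
  by rewrite lerDr mulr_ge0// ltW.
have [K KP] : exists K : nat, 8 * 2 `^ p * C * C < K%:R.
  by exists (Num.truncn (8 * 2 `^ p * C * C)).+1; exact: truncnS_gt.
have [M M0 [m mP]] := balanced_multiplicities K v0.
have [||sigma [sU sI sD]] :=
  @disjoint_selection (nat * nat)%type (fun il => U il.1) (fun il => v il.1).
- by move=> il; exact: Uuc.
- by move=> il s; exact: Uv.
have B0 : 0 < 2 * M * (C + K%:R * eta).
  by rewrite !mulr_gt0// ltr_pwDl// mulr_ge0// ltW.
have /(tau_bounded_below B0)/(_ 2^-1) : weak_le p w' (combination tau
    (block_indices K m) ((fun=> 1) \o fst) sigma) (2 * M * (C + K%:R * eta)).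
  move=> c c0; rewrite dist_tau_blocks//.
  apply: (@le_trans _ _ (\sum_(0 <= i < K)
      (2 * M / c `^ p * (eta + C * (jump c i)%:R))%:E)%E).
    rewrite big_seq [leRHS]big_seq; apply: lee_sum => i.
    rewrite mem_index_iota => /andP[_ iK].
    apply: (@le_trans _ _ (\sum_(0 <= l < m i)
        (v i / c `^ p * (eta + C * (jump c i)%:R))%:E)%E).
      by apply: lee_sum => l _; rewrite divr1; exact: dU (sU (i, l)).
    rewrite sumEFin big_const_nat subn0 iter_addr_0 lee_fin.
    rewrite -(mulr_natl _ (m i)) !mulrA.
    have /andP[_ mM] := mP _ iK.
    apply: ler_wpM2r; first by rewrite addr_ge0 ?(ltW eta0)// mulr_ge0// ltW.
    by apply: ler_wpM2r => //; rewrite invr_ge0 powR_ge0.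
  rewrite sumEFin lee_fin -mulr_sumr [leRHS]mulrAC.
  rewrite ler_pM2l ?divr_gt0 ?mulr_gt0 ?powR_gt0//.
  rewrite big_split /= [leRHS]addrC lerD//.
    by rewrite big_const_nat subn0 iter_addr_0 mulr_natl.
  rewrite -mulr_sumr -natr_sum -[leRHS]mulr1 ler_pM2l// -[leRHS]/(1%:R) ler_nat.
  by apply: leq_trans (jumps c K) _; case: ltP.
move=> /(_ (etrans (invr_gt0 _) (ltr0n _ 2))).
rewrite (dist_unit_blocks _ _ (v := v))//; last first.
  by move=> i l; exact: Uv (sU (i, l)).
rewrite lee_fin; apply/negP; rewrite -ltNge.
apply: (@lt_le_trans _ _ (\sum_(0 <= i < K) M)); last first.
  rewrite big_seq [leRHS]big_seq; apply: ler_sum => i.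
  rewrite mem_index_iota => /andP[_ /mP/andP[Mm _]].
  by rewrite invf_lt1// ltr1n.
rewrite big_const_nat subn0 iter_addr_0 -(mulr_natl M K).
have -> : (2^-1 : R) `^ p = (2 `^ p)^-1.
  by rewrite -powR_inv1// -powRrM mulrC powRrM powR_inv1 ?powR_ge0.
rewrite invrK.
have E : 4 * C * 2 `^ p * eta = 1.
  by rewrite mulfV// gt_eqF// !mulr_gt0// powR_gt0.
have -> : C * (2 * M * (C + K%:R * eta)) * 2 `^ p =
    (2 * 2 `^ p * C * C + K%:R * (2 * C * 2 `^ p * eta)) * M by lra.
have -> : 2 * C * 2 `^ p * eta = 2^-1 by lra.
by rewrite ltr_pM2r//; have := ler0n R K; lra.
Qed.

(** If the unit vectors of weight [v] are too numerous, then uncountably many of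
    their images vanish on all coordinates of weight below [La * v], because
    each coordinate excludes countably many vectors only.  By [dist_tau_eq0] the
    images are then small in supremum norm when [La] is large. *)
Lemma level_card_le : exists2 La, 0 < La &
  forall v (U : Type) (D : set U), infinite_set D ->
    [set t | (w' t)%:num < La * v] #<= D -> [set s | (w s)%:num = v] #<= D.
Proof.
apply: contrapT => noLa; apply: no_flat_images => c1 c10.
pose La := 2 * C / c1 `^ p.
have La0 : 0 < La by rewrite divr_gt0 ?powR_gt0// mulr_gt0.
apply: contrapT => noU; apply: noLa; exists La => // v X D Dinf TD.
pose U := [set s | (w s)%:num = v /\
  forall t, (w' t)%:num < La * v -> tau s t = 0].
have Uc : countable U.
  apply: contrapT => Uuc; apply: noU.
  exists v, U; split=> // [s []//|s c [ws Us] c1c].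
  have v0 : 0 < v by rewrite -ws.
  have c0 := lt_le_trans c10 c1c.
  apply: (dist_tau_eq0 (La := La * v) c0) => [t|].
    by apply: contra_neqT; rewrite -ltNge => /Us.
  rewrite ws mulrAC ltr_pM2r// (@lt_le_trans _ _ (La * c1 `^ p))//.
    by rewrite /La divfK ?gt_eqF ?powR_gt0// ltr_pMl// ltr1n.
  by rewrite ler_pM2l// ge0_ler_powR ?nnegrE ?(ltW c10) ?(ltW c0)// ltW.
pose F n := if n is 0%N then U else
  \bigcup_(t in [set t | (w' t)%:num < La * v])
    [set s | (w s)%:num = v /\ tau s t != 0].
apply: (@card_le_trans _ _ _ (\bigcup_n F n)).
  apply: subset_card_le => s /= ws.
  have [Us|nUs] := pselect (U s); first by exists 0%N.
  exists 1%N => //; apply: contrapT => nF; apply: nUs; split=> // t tLa.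
  by apply/eqP/negPn/negP => st; apply: nF; exists t.
apply: card_le_bigcup_nat => // -[|n].
  by apply: (card_le_trans Uc); apply/infiniteP.
apply: card_le_bigcup_countable => // t _.
exact: countable_coordinate.
Qed.

End UnitVectorFamily.

(** * Continuity and weak-type bounds *)

Section WeakLe.
Context (R : realType) (p : R) (p_gt1 : 1 < p).
Context (S : choiceType) (w : S -> {posnum R}).
Implicit Types (x : S -> R) (B : R).

Let p_gt0 : 0 < p. Proof. exact: lt_trans p_gt1. Qed.

Lemma weak_norm_leP x K : 0 <= K ->
  (weak_norm p w x <= K%:E)%E <-> weak_le p w x (K `^ p).
Proof.
move=> K0; have key (c : R) : 0 < c ->
    (c%:E * dist w x c `^ p^-1 <= K%:E)%E =
    (dist w x c <= (K `^ p / c `^ p)%:E)%E.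
  move=> c0; have := dist_ge0 w x c; case: (dist w x c) => [d|_|//].
    rewrite lee_fin => d0; rewrite poweR_EFin -EFinM !lee_fin.
    rewrite ler_pdivlMr ?powR_gt0// -[X in _ = (X * _ <= _)]powRr1//.
    rewrite -(mulVf (lt0r_neq0 p_gt0)) powRrM -powRM ?powR_ge0 ?(ltW c0)//.
    have H0 : 0 <= d `^ p^-1 * c by rewrite mulr_ge0 ?powR_ge0// ltW.
    rewrite [c * _]mulrC; apply/idP/idP => [le1|].
      by rewrite ge0_ler_powR ?nnegrE// ltW.
    by apply: contraTT; rewrite -!ltNge => lt1; rewrite gt0_ltr_powR ?nnegrE.
  by rewrite poweRyr ?invr_eq0 ?gt_eqF// gt0_muley ?lte_fin// !leye_eq.
split=> [xK c c0|xK]; first by rewrite -key// (le_trans _ xK)// weak_norm_ge.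
by apply: ge_ereal_sup => _ [c /= c0 <-]; rewrite key//; exact: xK.
Qed.

Lemma weak_le_homo x B B' : B <= B' -> weak_le p w x B -> weak_le p w x B'.
Proof.
move=> BB' xB c c0; apply: le_trans (xB c c0) _.
by rewrite lee_fin ler_wpM2r// invr_ge0 powR_ge0.
Qed.

Lemma weak_leZ a x B : 0 < a ->
  weak_le p w x B -> weak_le p w (fun s => a * x s) (a `^ p * B).
Proof.
move=> a0 xB c c0; rewrite distZ//; apply: le_trans (xB _ (divr_gt0 c0 a0)) _.
have -> : c `^ p = a `^ p * (c / a) `^ p.
  by rewrite -powRM ?divr_ge0 ?(ltW c0) ?(ltW a0)// mulrC divfK ?gt_eqF.
by rewrite -mulf_div divff ?gt_eqF ?powR_gt0// mul1r.
Qed.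

Lemma weak_norm_fin_num x B : 0 <= B -> weak_le p w x B ->
  (weak_norm p w x < +oo)%E.
Proof.
move=> B0 xB; apply: (@le_lt_trans _ _ (B `^ p^-1)%:E); last exact: ltry.
apply/weak_norm_leP; first exact: powR_ge0.
by rewrite -powRrM mulVf ?gt_eqF// powRr1.
Qed.

Lemma nbhs_weak_lpP (x : weak_lp p_gt1 w) (A : set (weak_lp p_gt1 w)) :
  nbhs x A <-> exists2 e, 0 < e &
    forall y : weak_lp p_gt1 w,
      (weak_norm p w (x - y : weak_lp p_gt1 w)%R < e%:E)%E -> A y.
Proof.
rewrite -nbhs_entourageE; split.
  move=> [E [e /= e0 eE] EA]; exists e => // y xye; apply: EA.
  by rewrite /xsection/= inE; exact: eE.
move=> [e e0 eA].
exists [set xy |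
    (weak_norm p w (xy.1 - xy.2 : weak_lp p_gt1 w)%R < e%:E)%E].
  by exists e.
by move=> y; rewrite /xsection/= inE/=; exact: eA.
Qed.

End WeakLe.

Section BoundedLinear.
Context (R : realType) (p : R) (p_gt1 : 1 < p).
Let p_gt0 : 0 < p. Proof. exact: lt_trans p_gt1. Qed.

(** Continuity at [0] bounds [f] on a neighborhood of [0], into which every
    vector can be scaled. *)
Lemma continuous_bounded (S1 S2 S1' S2' : choiceType)
    (w1 : S1 -> {posnum R}) (w2 : S2 -> {posnum R})
    (w1' : S1' -> {posnum R}) (w2' : S2' -> {posnum R})
    (f : {linear (weak_lp p_gt1 w1 * weak_lp p_gt1 w2)%type ->
                 (weak_lp p_gt1 w1' * weak_lp p_gt1 w2')%type}) :
  continuous f ->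
  exists2 C, 0 < C & forall (x : weak_lp p_gt1 w1 * weak_lp p_gt1 w2) B, 0 < B ->
    weak_le p w1 x.1 B -> weak_le p w2 x.2 B ->
    weak_le p w1' (f x).1 (C * B) /\ weak_le p w2' (f x).2 (C * B).
Proof.
move=> /(_ 0); rewrite /continuous_at linear0 => fc.
pose A := [set y : (weak_lp p_gt1 w1' * weak_lp p_gt1 w2')%type |
  (weak_norm p w1' (0 - y.1 : weak_lp p_gt1 w1')%R < 1%:E)%E /\
  (weak_norm p w2' (0 - y.2 : weak_lp p_gt1 w2')%R < 1%:E)%E].
have /fc : nbhs (0 : (weak_lp p_gt1 w1' * weak_lp p_gt1 w2')%type) A.
  exists
    ([set y : weak_lp p_gt1 w1' |
       (weak_norm p w1' (0 - y : weak_lp p_gt1 w1')%R < 1%:E)%E],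
     [set y : weak_lp p_gt1 w2' |
       (weak_norm p w2' (0 - y : weak_lp p_gt1 w2')%R < 1%:E)%E]).
    by split; apply/nbhs_weak_lpP; exists 1.
  by move=> [y1 y2] [].
move=> [[A1 A2] [/= /nbhs_weak_lpP[e1 e10 A1e] /nbhs_weak_lpP[e2 e20 A2e]] AA].
pose e := Num.min e1 e2 / 2; have e0 : 0 < e by rewrite divr_gt0// lt_min e10.
exists ((e^-1) `^ p); first by apply: powR_gt0; rewrite invr_gt0.
move=> x B B0 x1B x2B.
have ei e' : e < e' -> forall (S : choiceType) (w : S -> {posnum R})
    (y : weak_lp p_gt1 w), weak_le p w y (e `^ p) ->
    (weak_norm p w (0 - y : weak_lp p_gt1 w)%R < e'%:E)%E.
  move=> ee' S w y ye; rewrite sub0r weak_normN; apply: (@le_lt_trans _ _ e%:E).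
    exact/(weak_norm_leP p_gt1 _ _ (ltW e0)).
  by rewrite lte_fin.
have [ee1 ee2] : e < e1 /\ e < e2.
  have m0 : 0 < Num.min e1 e2 by rewrite lt_min e10.
  have em : e < Num.min e1 e2 by rewrite /e; lra.
  by move: em; rewrite lt_min => /andP[].
pose k := e / B `^ p^-1; have k0 : 0 < k by rewrite divr_gt0 ?powR_gt0.
have kB : k `^ p * B = e `^ p.
  have BE : (B `^ p^-1) `^ p = B.
    by rewrite -powRrM mulVf ?gt_eqF// powRr1// ltW.
  rewrite -[X in _ * X]BE -powRM ?(ltW k0) ?powR_ge0//.
  by rewrite divfK ?gt_eqF ?powR_gt0.
have Akx : A (f (k *: x)).
  apply: AA; split => /=.
    by apply: A1e; apply: ei ee1 _ _ _ _; rewrite -kB; exact: weak_leZ.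
  by apply: A2e; apply: ei ee2 _ _ _ _; rewrite -kB; exact: weak_leZ.
have back (S : choiceType) (w : S -> {posnum R}) (y : weak_lp p_gt1 w) :
    (weak_norm p w (0 - k *: y : weak_lp p_gt1 w)%R < 1%:E)%E ->
    weak_le p w y (e^-1 `^ p * B).
  rewrite sub0r weak_normN => /ltW/(weak_norm_leP p_gt1 _ _ ler01).
  have ik0 : 0 < k^-1 by rewrite invr_gt0.
  move=> /(weak_leZ ik0); rewrite powR1 mulr1.
  have -> : (fun s => k^-1 * (k *: y : weak_lp p_gt1 w) s) = y.
    by apply/funext => s; rewrite /= /GRing.scale/= mulrA mulVf ?gt_eqF// mul1r.
  suff -> : k^-1 `^ p = e^-1 `^ p * B by [].
  rewrite /k invfM invrK powRM ?powR_ge0 ?invr_ge0 ?(ltW e0)//.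
  by rewrite -powRrM mulVf ?gt_eqF// powRr1// ltW.
by move: Akx; rewrite linearZ => -[/back ? /back ?].
Qed.

End BoundedLinear.

(** * Direct sums as spaces over a disjoint union *)

Section SumIndex.
Context (R : realType) (p : R).
Context (S1 S2 : choiceType) (w1 : S1 -> {posnum R}) (w2 : S2 -> {posnum R}).

Definition sum_weight (s : S1 + S2) : {posnum R} :=
  match s with inl a => w1 a | inr b => w2 b end.

Definition sum_fun (x : S1 -> R) (y : S2 -> R) (s : S1 + S2) : R :=
  match s with inl a => x a | inr b => y b end.

Lemma dist_sum_fun x y c :
  dist sum_weight (sum_fun x y) c = (dist w1 x c + dist w2 y c)%E.
Proof.
pose A := [set a | c < `|x a|]; pose B := [set b | c < `|y b|].
have -> : dist sum_weight (sum_fun x y) c =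
    weight_measure sum_weight (inl @` A `|` inr @` B).
  congr weight_measure; apply/seteqP; split=> [[a|b] /= ?|[a|b]].
  - by left; exists a.
  - by right; exists b.
  - by move=> [[? ? [<-]]|[]].
  - by move=> [[]|[? ? [<-]]].
rewrite weight_measure_disjointU; last first.
  by apply/seteqP; split=> // _ [[a _ <-] []].
by rewrite /weight_measure !esum_image// => a b _ _ [].
Qed.

Lemma weak_le_sum_fun x y B : weak_le p w1 x B -> weak_le p w2 y B ->
  weak_le p sum_weight (sum_fun x y) (2 * B).
Proof.
move=> xB yB c c0; rewrite dist_sum_fun.
rewrite (_ : 2 * B / _ = B / c `^ p + B / c `^ p).
  by rewrite EFinD leeD ?xB ?yB.
by rewrite -mulrA mulr_natl mulr2n.
Qed.

Lemma weak_le_sum_funl x y B : weak_le p sum_weight (sum_fun x y) B ->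
  weak_le p w1 x B.
Proof.
move=> xyB c c0; apply: le_trans (xyB c c0).
by rewrite dist_sum_fun leeDl ?dist_ge0.
Qed.

Lemma weak_le_sum_funr x y B : weak_le p sum_weight (sum_fun x y) B ->
  weak_le p w2 y B.
Proof.
move=> xyB c c0; apply: le_trans (xyB c c0).
by rewrite dist_sum_fun leeDr ?dist_ge0.
Qed.

End SumIndex.

Section UnitVectors.
Context (R : realType) (p : R) (p_gt1 : 1 < p).

Let p_gt0 : 0 < p. Proof. exact: lt_trans p_gt1. Qed.

Lemma weak_norm_unit_vector (S : choiceType) (w : S -> {posnum R}) s :
  (weak_norm p w (unit_vector R s) < +oo)%E.
Proof.
apply: (@weak_norm_fin_num _ _ p_gt1 _ _ _ (w s)%:num) => // c c0.
rewrite dist_indic ?(ltW c0)// lee_fin; case: ifPn => [c1|_].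
  rewrite ler_pdivlMr ?powR_gt0// ler_piMr//.
  exact: powR_lt1_le1 (ltW p_gt0) _ _.
by rewrite divr_ge0// powR_ge0.
Qed.

Definition unit_weak_lp (S : choiceType) (w : S -> {posnum R}) (s : S) :
  weak_lp p_gt1 w := WeakLp p_gt1 (weak_norm_unit_vector w s).

Context (S1 S2 : choiceType) (w1 : S1 -> {posnum R}) (w2 : S2 -> {posnum R}).
Local Notation V := (weak_lp p_gt1 w1 * weak_lp p_gt1 w2)%type.

Definition unit_pair (s : S1 + S2) : V :=
  match s with
  | inl a => (unit_weak_lp w1 a, 0)
  | inr b => (0, unit_weak_lp w2 b)
  end.

Definition pair_fun (x : V) : S1 + S2 -> R := sum_fun x.1 x.2.

Lemma pair_funD x y s : pair_fun (x + y) s = pair_fun x s + pair_fun y s.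
Proof. by case: s. Qed.

Lemma pair_funZ a x s : pair_fun (a *: x) s = a * pair_fun x s.
Proof. by case: s. Qed.

Lemma pair_fun0 s : pair_fun 0 s = 0.
Proof. by case: s. Qed.

Lemma pair_fun_unit s : pair_fun (unit_pair s) = unit_vector R s.
Proof.
by apply/funext => t; case: s => [a|b]; case: t => [a'|b'].
Qed.

End UnitVectors.

Section Images.
Context (R : realType) (p : R) (p_gt1 : 1 < p).
Context (S1 S2 S1' S2' : choiceType).
Context (w1 : S1 -> {posnum R}) (w2 : S2 -> {posnum R}).
Context (w1' : S1' -> {posnum R}) (w2' : S2' -> {posnum R}).
Local Notation V := (weak_lp p_gt1 w1 * weak_lp p_gt1 w2)%type.
Local Notation V' := (weak_lp p_gt1 w1' * weak_lp p_gt1 w2')%type.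

(** The family to which the estimates on images of unit vectors apply. *)
Definition unit_image (f : V -> V') (s : S1 + S2) : S1' + S2' -> R :=
  pair_fun (f (unit_pair p_gt1 w1 w2 s)).

Lemma combination_unit_image (f : {linear V -> V'}) (J : Type) (r : seq J) a s :
  combination (unit_image f) r a s =
  pair_fun (f (\sum_(j <- r) a j *: unit_pair p_gt1 w1 w2 (s j))).
Proof.
apply/funext => t; rewrite /combination; elim: r => [|j r IH].
  by rewrite !big_nil linear0 pair_fun0.
by rewrite !big_cons linearD linearZ pair_funD pair_funZ IH.
Qed.

Lemma combination_unit_vector (J : Type) (r : seq J) a (s : J -> S1 + S2) :
  combination (@unit_vector R _) r a s =
  pair_fun (\sum_(j <- r) a j *: unit_pair p_gt1 w1 w2 (s j)).
Proof.
apply/funext => t; rewrite /combination; elim: r => [|j r IH].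
  by rewrite !big_nil pair_fun0.
by rewrite !big_cons pair_funD pair_funZ IH pair_fun_unit.
Qed.

Lemma continuous_pair_bounded (f : {linear V -> V'}) : continuous f ->
  exists2 C, 0 < C & forall x B, 0 < B ->
    weak_le p (sum_weight w1 w2) (pair_fun x) B ->
    weak_le p (sum_weight w1' w2') (pair_fun (f x)) (C * B).
Proof.
move=> /continuous_bounded[C C0 fC]; exists (2 * C); first by rewrite mulr_gt0.
move=> x B B0 xB; have [||y1 y2] := fC x B B0.
- exact: weak_le_sum_funl xB.
- exact: weak_le_sum_funr xB.
by rewrite -mulrA; exact: weak_le_sum_fun.
Qed.

End Images.

(** The invariant behind the necessity of both conditions: it compares the
    numbers of coordinates of each weight in two isomorphic spaces, with the
    isomorphism entering through the single constant [La]. *)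
Lemma isomorphic_level_card_le (R : realType) (p : R) (p_gt1 : 1 < p)
    (S1 S2 S1' S2' : choiceType)
    (w1 : S1 -> {posnum R}) (w2 : S2 -> {posnum R})
    (w1' : S1' -> {posnum R}) (w2' : S2' -> {posnum R}) :
  isomorphic (weak_lp p_gt1 w1 * weak_lp p_gt1 w2)%type
             (weak_lp p_gt1 w1' * weak_lp p_gt1 w2')%type ->
  exists2 La, 0 < La & forall v (U : Type) (D : set U), infinite_set D ->
    [set t | (sum_weight w1' w2' t)%:num < La * v] #<= D ->
    [set s | (sum_weight w1 w2 s)%:num = v] #<= D.
Proof.
move=> [f [g [gf fg /continuous_pair_bounded[C C0 fC]]]].
move=> /continuous_pair_bounded[C' C'0 gC'].
have CC'0 : 0 < C + C' by rewrite addr_gt0.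
apply: (level_card_le p_gt1 (tau := unit_image f) CC'0).
  move=> J r a s B B0.
  rewrite combination_unit_image (combination_unit_vector p_gt1 w1 w2).
  move=> /(fC _ _ B0); apply: weak_le_homo.
  by rewrite ler_pM2r// lerDl ltW.
move=> J r a s B B0.
rewrite combination_unit_image (combination_unit_vector p_gt1 w1 w2).
move=> /(gC' _ _ B0); rewrite gf; apply: weak_le_homo.
by rewrite ler_pM2r// lerDr ltW.
Qed.

(** * Constructing isomorphisms *)

Definition linear_pack (R : numDomainType) (V W : preTopologicalLmodType R)
    (f : V -> W) (fL : linear f) : {linear V -> W} :=
  HB.pack f (GRing.isLinear.Build R V W *:%R f fL).

Lemma isomorphic_prod (R : numDomainType)
    (V V' W W' : preTopologicalLmodType R) :
  isomorphic V V' -> isomorphic W W' -> isomorphic (V * W)%type (V' * W')%type.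
Proof.
move=> [f [f' [fK f'K fc f'c]]] [g [g' [gK g'K gc g'c]]].
have fgL : linear (fun x : V * W => (f x.1, g x.2)).
  by move=> a [x1 x2] [y1 y2]; congr (_, _) => /=; rewrite linearP.
have fgL' : linear (fun x : V' * W' => (f' x.1, g' x.2)).
  by move=> a [x1 x2] [y1 y2]; congr (_, _) => /=; rewrite linearP.
exists (linear_pack fgL), (linear_pack fgL'); split.
- by move=> [x y] /=; rewrite fK gK.
- by move=> [x y] /=; rewrite f'K g'K.
- move=> [x y]; apply: cvg_pair.
    by apply: (@cvg_comp _ _ _ fst f _ (nbhs x)); [exact: cvg_fst|exact: fc].
  by apply: (@cvg_comp _ _ _ snd g _ (nbhs y)); [exact: cvg_snd|exact: gc].
- move=> [x y]; apply: cvg_pair.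
    by apply: (@cvg_comp _ _ _ fst f' _ (nbhs x)); [exact: cvg_fst|exact: f'c].
  by apply: (@cvg_comp _ _ _ snd g' _ (nbhs y)); [exact: cvg_snd|exact: g'c].
Qed.

Section Reindex.
Context (R : realType) (p : R) (p_gt1 : 1 < p).

Let p_gt0 : 0 < p. Proof. exact: lt_trans p_gt1. Qed.

Lemma bounded_continuous (S S' : choiceType) (w : S -> {posnum R})
    (w' : S' -> {posnum R})
    (f : {linear weak_lp p_gt1 w -> weak_lp p_gt1 w'}) D :
    0 < D -> (forall (x : weak_lp p_gt1 w) B, 0 < B ->
      weak_le p w x B -> weak_le p w' (f x) (D * B)) ->
  continuous f.
Proof.
move=> D0 fD x A /nbhs_weak_lpP[e e0 eA]; apply/nbhs_weak_lpP.
pose d := e / (2 * D `^ p^-1).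
have D10 : 0 < D `^ p^-1 by rewrite powR_gt0.
have d0 : 0 < d by rewrite divr_gt0// mulr_gt0.
exists d => // y /ltW /(weak_norm_leP p_gt1 _ _ (ltW d0)) xyd; apply: eA.
rewrite -linearB; apply: (@le_lt_trans _ _ (D `^ p^-1 * d)%:E).
  apply/(weak_norm_leP p_gt1); first by rewrite ltW// mulr_gt0.
  rewrite powRM ?(ltW D10) ?(ltW d0)// -powRrM mulVf ?gt_eqF//.
  by rewrite powRr1 ?(ltW D0)//; apply: fD => //; rewrite powR_gt0.
rewrite lte_fin /d invfM mulrCA [X in e * X]mulrCA divff ?gt_eqF// mulr1.
by rewrite ltr_pdivrMr// ltr_pMr// ltr1n.
Qed.

Section ReindexMap.
Context (S S' : choiceType) (w : S -> {posnum R}) (w' : S' -> {posnum R}).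
Context (h : S -> S') (h' : S' -> S) (hK : cancel h h') (h'K : cancel h' h).
Context (C : R) (C_gt0 : 0 < C).
Context (w'C : forall s, (w' (h s))%:num <= C * (w s)%:num).

Lemma weak_le_reindex (x : S -> R) B :
  weak_le p w x B -> weak_le p w' (x \o h') (C * B).
Proof.
move=> xB c c0; apply: (@le_trans _ _ (C%:E * dist w x c)%E); last first.
  by rewrite -mulrA EFinM lee_pmul2l//; exact: xB.
rewrite /dist (_ : [set s | _] = h @` [set s | c < `|x s|]); last first.
  apply/seteqP; split=> [s' /= ?|_ [s /= ? <-]]; last by rewrite /= hK.
  by exists (h' s').
rewrite /weight_measure esum_image; last by move=> s t _ _; exact: (can_inj hK).
apply: ge_ereal_sup => _ [X [Xfin XA] <-].
apply: (@le_trans _ _ (\sum_(s \in X) (C%:E * ((w s)%:num)%:E))%E).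
  by apply: lee_fsum => // s _; rewrite -EFinM lee_fin.
rewrite -ge0_mule_fsumr; last by move=> s; rewrite lee_fin.
by rewrite lee_pmul2l//; apply: ereal_sup_ubound; exists X.
Qed.

Lemma weak_norm_reindex (x : weak_lp p_gt1 w) :
  (weak_norm p w' (x \o h') < +oo)%E.
Proof.
have := weak_lpP x; rewrite unfold_in => xoo.
have x0 := weak_norm_ge0 p w x.
have xE : weak_norm p w x = (fine (weak_norm p w x))%:E.
  by rewrite fineK// ge0_fin_numE.
have K0 : 0 <= fine (weak_norm p w x) by rewrite -lee_fin -xE.
have xB : weak_le p w x (fine (weak_norm p w x) `^ p).
  by apply/(weak_norm_leP p_gt1) => //; rewrite -xE.
apply: (weak_norm_fin_num p_gt1 _ (weak_le_reindex xB)).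
by rewrite mulr_ge0 ?powR_ge0// ltW.
Qed.

Definition reindex (x : weak_lp p_gt1 w) : weak_lp p_gt1 w' :=
  WeakLp p_gt1 (weak_norm_reindex x).

Lemma reindex_linear : linear reindex.
Proof. by move=> a x y; apply/val_inj/funext => s. Qed.

End ReindexMap.

(** Multiplying all weights by at most [C] multiplies every distribution
    function by at most [C], and both directions of the bijection do so. *)
Lemma isomorphic_reindex (S S' : choiceType) (w : S -> {posnum R})
    (w' : S' -> {posnum R}) (h : S -> S') (h' : S' -> S) (C : R) :
    cancel h h' -> cancel h' h -> 0 < C ->
    (forall s, (w' (h s))%:num <= C * (w s)%:num) ->
    (forall s, (w s)%:num <= C * (w' (h s))%:num) ->
  isomorphic (weak_lp p_gt1 w) (weak_lp p_gt1 w').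
Proof.
move=> hK h'K C0 w'C wC.
have wC' s' : (w (h' s'))%:num <= C * (w' s')%:num by rewrite -{2}(h'K s').
exists (linear_pack (reindex_linear hK h'K C0 w'C)),
       (linear_pack (reindex_linear h'K hK C0 wC')); split.
- by move=> x; apply/val_inj/funext => s /=; rewrite hK.
- by move=> x; apply/val_inj/funext => s /=; rewrite h'K.
- by apply: (bounded_continuous C0) => x B _; exact: weak_le_reindex.
- by apply: (bounded_continuous C0) => x B _; exact: weak_le_reindex.
Qed.

End Reindex.

(** No injection needs to be onto: the bijection of [piecewise_bernstein] agrees
    at every point with [f] or with the inverse of [g], so it obeys the same
    bounds as these. *)
Lemma isomorphic_bernstein (R : realType) (p : R) (p_gt1 : 1 < p)
    (S S' : choiceType) (w : S -> {posnum R}) (w' : S' -> {posnum R})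
    (f : S -> S') (g : S' -> S) (C : R) :
    injective f -> injective g -> 0 < C ->
    (forall s, (w' (f s))%:num <= C * (w s)%:num) ->
    (forall s, (w s)%:num <= C * (w' (f s))%:num) ->
    (forall s, (w (g s))%:num <= C * (w' s)%:num) ->
    (forall s, (w' s)%:num <= C * (w (g s))%:num) ->
  isomorphic (weak_lp p_gt1 w) (weak_lp p_gt1 w').
Proof.
move=> fI gI C0 w'f wf wg w'g.
have [h [h' [hK h'K hE]]] := piecewise_bernstein fI gI.
apply: (isomorphic_reindex p_gt1 hK h'K C0) => s.
  by have [->//|sE] := hE s; rewrite [X in w X]sE.
by have [->//|sE] := hE s; rewrite [X in w X]sE.
Qed.

Lemma isomorphic_sym (R : numDomainType) (V W : preTopologicalLmodType R) :
  isomorphic V W -> isomorphic W V.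
Proof. by move=> [f [g [? ? ? ?]]]; exists g, f. Qed.

(** * The spaces E and F *)

Lemma block_index_eq (T : choiceType) (G : nat -> set T) n t :
  trivIset setT G -> G n t -> block_index G t = n.
Proof.
move=> tG Gnt; rewrite /block_index; case: xgetP => [m _ /= Gmt|/(_ n)//].
by apply: tG => //; exists t.
Qed.

Lemma block_index_mem (T : choiceType) (G : nat -> set T) (t : \bigcup_n G n) :
  G (block_index G (val t)) (val t).
Proof.
have [n _ Gnt] : (\bigcup_n G n) (val t) by exact: set_valP.
by rewrite /block_index; case: xgetP => [m _ //|/(_ n)].
Qed.

Lemma E_embedding (T U : choiceType) (A : nat -> set T) (B : nat -> set U) k :
    trivIset setT A -> trivIset setT B -> (forall n, A n #<= B (n + k)%N) ->
  exists f : \bigcup_n A n -> \bigcup_n B n, injective f /\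
    forall t, block_index B (val (f t)) = (block_index A (val t) + k)%N.
Proof.
move=> tA tB AB.
have [[t0 _]|A0] := pselect (exists t : \bigcup_n A n, True); last first.
  have F (t : \bigcup_n A n) : False by apply: A0; exists t.
  by exists (fun t => match F t with end); split=> t; case: (F t).
have [u0] : $|U|.
  have /card_le_fun[f _] := AB (block_index A (val t0)).
  by squash (val (f (exist _ (val t0) (mem_set (block_index_mem t0))))).
have /choice[g gP] n : exists g : T -> U,
    set_fun (A n) (B (n + k)%N) g /\ set_inj (A n) g.
  by have [g gD gI] := card_le_inj_on u0 (AB n); exists g.
pose ix (t : \bigcup_n A n) := block_index A (val t).
have gB t : B (ix t + k)%N (g (ix t) (val t)).
  by apply: (gP _).1; exact: block_index_mem.
have gU t : (\bigcup_n B n) (g (ix t) (val t)) by exists (ix t + k)%N.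
exists (fun t => exist _ (g (ix t) (val t)) (mem_set (gU t))).
have ixE t : block_index B (g (ix t) (val t)) = (ix t + k)%N.
  exact: block_index_eq.
split=> [s t /(congr1 val) /= gst|t]; last exact: ixE.
have ist : ix s = ix t.
  by apply: (@addIn k); rewrite -!ixE gst.
apply: val_inj; apply: ((gP (ix t)).2); rewrite ?inE.
- by rewrite -ist; exact: block_index_mem.
- exact: block_index_mem.
- by rewrite -{1}ist.
Qed.

Lemma F_embedding (T U : choiceType) (A : set T) (B : set U) : A #<= B ->
  exists f : A `*` [set n : nat | (0 < n)%N] -> B `*` [set n : nat | (0 < n)%N],
    injective f /\ forall t, (val (f t)).2 = (val t).2.
Proof.
move=> /card_le_fun[e eI].
have A1 (t : A `*` [set n : nat | (0 < n)%N]) : A (val t).1.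
  by have [] : (A `*` [set n : nat | (0 < n)%N]) (val t) by exact: set_valP.
have A2 (t : A `*` [set n : nat | (0 < n)%N]) : (0 < (val t).2)%N.
  by have [] : (A `*` [set n : nat | (0 < n)%N]) (val t) by exact: set_valP.
pose e' t := val (e (exist _ (val t).1 (mem_set (A1 t)))).
have fB t : (B `*` [set n : nat | (0 < n)%N]) (e' t, (val t).2).
  by split; [exact: set_valP|exact: A2].
exists (fun t => exist _ (e' t, (val t).2) (mem_set (fB t))); split=> // s t.
move=> /(congr1 val) /= [/val_inj/eI/(congr1 val)/= st1 st2].
exact: val_inj (injective_projections _ _ st1 st2).
Qed.

Section EF.
Context (R : realType) (p : R) (p_gt1 : 1 < p).

Lemma E_space_isomorphic (T U : choiceType) (A : nat -> set T)
    (B : nat -> set U) k :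
    trivIset setT A -> trivIset setT B ->
    (forall n, A n #<= B (n + k)%N) -> (forall n, B n #<= A (n + k)%N) ->
  isomorphic (E_space p_gt1 A) (E_space p_gt1 B).
Proof.
move=> tA tB AB BA; have [f [fI fk]] := E_embedding tA tB AB.
have [g [gI gk]] := E_embedding tB tA BA.
have k0 : 1 <= 2 ^+ k :> R by rewrite exprn_ege1// ler1n.
have bound n : (2 : R) ^+ n <= 2 ^+ k * 2 ^+ (n + k).
  rewrite exprD mulrCA ler_peMr ?exprn_ge0//.
  by rewrite -[leLHS]mulr1 ler_pM.
apply: (isomorphic_bernstein p_gt1 (C := 2 ^+ k) fI gI); first exact: exprn_gt0.
- by move=> s /=; rewrite fk exprD mulrC.
- by move=> s /=; rewrite fk.
- by move=> s /=; rewrite gk exprD mulrC.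
- by move=> s /=; rewrite gk.
Qed.

Lemma F_space_isomorphic (T U : choiceType) (A : set T) (B : set U) :
  A #= B -> isomorphic (F_space p_gt1 A) (F_space p_gt1 B).
Proof.
rewrite card_eq_le => /andP[/F_embedding[f [fI f2]] /F_embedding[g [gI g2]]].
by apply: (isomorphic_bernstein p_gt1 (C := 1) fI gI) => // s /=;
   rewrite ?f2 ?g2 mul1r.
Qed.

Section Levels.
Context (T U : choiceType) (A : nat -> set T) (B : set U).
Hypothesis tA : trivIset setT A.
Local Notation W := (sum_weight (@E_weight R T A) (@F_weight R U B)).

Lemma card_le_E_level n : A n #<= [set s | (W s)%:num = 2 ^+ n].
Proof.
have [[t0 _]|/nonemptyPn ->] := pselect (A n !=set0); last exact: card_ge0.
apply: (@surj_on_card_ge _ _ _ _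
  (fun s => match s with inl t => val t | inr _ => t0 end)) => t Ant.
have At : (\bigcup_n A n) t by exists n.
exists (inl (exist _ t (mem_set At))) => //=.
by rewrite (block_index_eq tA Ant).
Qed.

Lemma card_le_F_level k : (0 < k)%N -> B #<= [set s | (W s)%:num = 2 ^- k].
Proof.
move=> k0.
have [[u0 _]|/nonemptyPn ->] := pselect (B !=set0); last exact: card_ge0.
apply: (@surj_on_card_ge _ _ _ _
  (fun s => match s with inl _ => u0 | inr u => (val u).1 end)) => u Bu.
have Buk : (B `*` [set n : nat | (0 < n)%N]) (u, k) by [].
by exists (inr (exist _ (u, k) (mem_set Buk))).
Qed.

(** All weights of the summand E are at least [1], and those of the summand F
    are at most [1 / 2]. *)
Lemma card_le_F_part : infinite_set B -> [set s | (W s)%:num < 1] #<= B.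
Proof.
move=> Binf.
pose P n : set ((\bigcup_n A n) + (B `*` [set n : nat | (0 < n)%N])) :=
  [set s | exists2 u, s = inr u & (val u).2 = n].
apply: (@card_le_trans _ _ _ (\bigcup_n P n)).
  apply: subset_card_le => -[t|u] /=; last by exists (val u).2 => //; exists u.
  by rewrite ltNge exprn_ege1// ler1n.
apply: card_le_bigcup_nat => // n; have [u0 Bu0] := infinite_setN0 Binf.
apply: (@inj_on_card_le _ _ _ _
  (fun s => match s with inl _ => u0 | inr u => (val u).1 end)).
  move=> _ [u -> _].
  by have [] : (B `*` [set n : nat | (0 < n)%N]) (val u) by exact: set_valP.
move=> s t; rewrite !inE => -[u -> un] [v -> vn] uv; congr inr; apply: val_inj.
by apply: injective_projections => //; rewrite un.
Qed.

Lemma card_le_EF_part (V : Type) (D : set V) n :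
  infinite_set B -> infinite_set D -> B #<= D ->
  (forall i, (i < n)%N -> A i #<= D) ->
  [set s | (W s)%:num < 2 ^+ n] #<= D.
Proof.
move=> Binf Dinf BD AD.
pose P i : set ((\bigcup_n A n) + (B `*` [set n : nat | (0 < n)%N])) :=
  if i is j.+1 then [set s | (W s)%:num = 2 ^+ j /\ (j < n)%N]
  else [set s | (W s)%:num < 1].
apply: (@card_le_trans _ _ _ (\bigcup_i P i)).
  apply: subset_card_le => -[t|u] /=.
    by rewrite ltr_eXn2l ?ltr1n// => tn; exists (block_index A (val t)).+1.
  move=> _; exists 0%N => //=.
  have [_ /= u0] : (B `*` [set n : nat | (0 < n)%N]) (val u) by exact: set_valP.
  by rewrite invf_lt1 ?exprn_gt0// exprn_egt1 ?ltr1n// -lt0n.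
apply: card_le_bigcup_nat => // -[|j].
  exact: card_le_trans (card_le_F_part Binf) BD.
have [jn|nj] := ltnP j n; last first.
  rewrite (_ : P j.+1 = set0); first exact: card_ge0.
  by apply/seteqP; split=> // s [_]; rewrite ltnNge nj.
apply: (card_le_trans _ (AD j jn)).
apply: (@card_le_trans _ _ _
    [set t : \bigcup_n A n | block_index A (val t) = j]).
  apply: (@surj_on_card_ge _ _ _ _ inl) => -[t|u] [/= ws _].
    by exists t => //=; apply: ieexprIn ws; rewrite ?ltr1n// gt_eqF// ltr1n.
  have : (2 : R) ^- (val u).2 < 1.
    have [_ /= u0] : (B `*` [set n : nat | (0 < n)%N]) (val u) by exact: set_valP.
    by rewrite invf_lt1 ?exprn_gt0// exprn_egt1 ?ltr1n// -lt0n.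
  by rewrite ws ltNge exprn_ege1// ler1n.
apply: (@inj_on_card_le _ _ _ _ val) => [t /= <-|s t _ _]; last exact: val_inj.
exact: block_index_mem.
Qed.

End Levels.

Lemma card_le_mono (T : Type) (A : nat -> set T) : (forall n, A n #<= A n.+1) ->
  forall m n, (m <= n)%N -> A m #<= A n.
Proof.
move=> AS m n /subnK <-; elim: (n - m)%N => [|d IH]; first exact: card_lexx.
exact: card_le_trans IH (AS _).
Qed.

(** One direction of each of the two comparisons; the other ones follow from the
    inverse isomorphism. *)
Lemma isomorphic_card_le (T T1 T2 : choiceType) (Gamma : set T)
    (A1 : nat -> set T1) (A2 : nat -> set T2)
    (adm1 : admissible Gamma A1) (adm2 : admissible Gamma A2)
    (U1 U2 : choiceType) (B1 : set U1) (B2 : set U2) :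
    card_lt [set: nat] B2 -> card_lt B2 Gamma ->
    isomorphic (E_space p_gt1 A1 * F_space p_gt1 B1)%type
               (E_space p_gt1 A2 * F_space p_gt1 B2)%type ->
  B1 #<= B2 /\ exists k, forall n, A1 n #<= A2 (n + k)%N.
Proof.
move=> [/infiniteP B2inf _] [B2G nB2G] /isomorphic_level_card_le[La La0 level].
have [tA1 _ _ _] := adm1; have [tA2 A2S _ [_ A2sup]] := adm2.
have [k0 Lak0] : exists k0 : nat, La <= 2 ^+ k0.
  exists (Num.truncn La).+1; apply: le_trans (ltW (truncnS_gt La)) _.
  by rewrite -natrX ler_nat ltnW// ltn_expl.
have two0 n : 0 < (2 : R) ^+ n by rewrite exprn_gt0.
split.
  apply: (card_le_trans (card_le_F_level A1 B1 (ltn0Sn k0))).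
  apply: level => //; apply: card_le_trans (card_le_F_part A2 B2inf).
  apply: subset_card_le => t /= /lt_le_trans; apply.
  rewrite ler_pdivrMr// mul1r (le_trans Lak0)//.
  by rewrite ler_eXn2l ?ltr1n.
(* Otherwise every [A2 n], hence also [Gamma], would embed into [B2]. *)
have [n0 B2n0] : exists n0, B2 #<= A2 n0.
  apply: contrapT => /forallNP nB2; move/negP: nB2G; apply.
  apply: Cantor_Bernstein => //; apply: A2sup => n.
  by have [//|/nB2] := card_le_total (A2 n) B2.
exists (k0 + n0)%N => n; apply: (card_le_trans (card_le_E_level B1 tA1 n)).
have A2n : B2 #<= A2 (n + (k0 + n0))%N.
  apply: (card_le_trans B2n0); apply: card_le_mono => //.
  by rewrite addnA leq_addl.
apply: level.
  by move=> /(card_le_finite A2n).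
apply: (@card_le_trans _ _ _
    [set s | (sum_weight (@E_weight R _ A2) (@F_weight R _ B2) s)%:num <
             2 ^+ (n + (k0 + n0))]).
  apply: subset_card_le => t /= /lt_le_trans; apply.
  rewrite addnC exprD ler_pM2r// (le_trans Lak0)// ler_eXn2l ?ltr1n//.
  exact: leq_addr.
apply: card_le_EF_part => // [|i /ltnW ile].
  by move=> /(card_le_finite A2n).
exact: card_le_mono.
Qed.

End EF.

Theorem theorem23 (R : realType) (p : R) (p_gt1 : 1 < p)
    (T TPi TDelta : choiceType) (Gamma : set T)
    (Gamma_uncountable : ~ countable Gamma)
    (Pi_ : nat -> set TPi) (Delta_ : nat -> set TDelta)
    (Pi_admissible : admissible Gamma Pi_)
    (Delta_admissible : admissible Gamma Delta_)
    (UPi UDelta : choiceType) (Pi : set UPi) (Delta : set UDelta)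
    (Pi_uncountable : card_lt [set: nat] Pi) (Pi_lt : card_lt Pi Gamma)
    (Delta_uncountable : card_lt [set: nat] Delta)
    (Delta_lt : card_lt Delta Gamma) :
  isomorphic (E_space p_gt1 Pi_ * F_space p_gt1 Pi)%type
             (E_space p_gt1 Delta_ * F_space p_gt1 Delta)%type
  <->
  (Pi #= Delta /\
   exists2 k : nat, (0 < k)%N &
     forall n : nat, Pi_ n #<= Delta_ (n + k)%N /\
                     Delta_ (n + k)%N #<= Pi_ (n + k.*2)%N).
Proof.
have [tPi PiS _ _] := Pi_admissible.
have [tDelta DeltaS _ _] := Delta_admissible.
have PiM := card_le_mono PiS; have DeltaM := card_le_mono DeltaS.
split=> [iso|[PiDelta [k _ Pik]]].
  have [PD [k kP]] := isomorphic_card_le Pi_admissible Delta_admissible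
    Delta_uncountable Delta_lt iso.
  have [DP [l lP]] := isomorphic_card_le Delta_admissible Pi_admissible
    Pi_uncountable Pi_lt (isomorphic_sym iso).
  split; first exact: Cantor_Bernstein.
  exists (k + l).+1 => // n; split.
    apply: (card_le_trans (kP n)); apply: DeltaM.
    by rewrite leq_add2l -addnS leq_addr.
  apply: (card_le_trans (lP _)); apply: PiM.
  by rewrite -addnA leq_add2l -addnn leq_add2l -addSn leq_addl.
(* A common shift for both inclusions: [Delta_ n] lies below [Delta_ (n + k)]
   and so below [Pi_ (n + k.*2)]. *)
apply: isomorphic_prod; last exact: F_space_isomorphic.
apply: (@E_space_isomorphic _ _ _ _ _ _ _ k.*2) => // n.
  apply: (card_le_trans (Pik n).1); apply: DeltaM.
  by rewrite leq_add2l -addnn leq_addr.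
by apply: (card_le_trans _ (Pik n).2); apply: DeltaM; rewrite leq_addr.
Qed.
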